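(* Let $w\in\mathcal{W}_\beta$ be a weighting function with $\beta\geqslant 1$, and let $\widetilde\Delta$ be an approximation function satisfying $x^{\varepsilon}\leqslant\widetilde\Delta(x)\leqslant\exp(x^{\zeta})$ for some $\varepsilon>0$ and $0<\zeta<\beta^{-1}$. Then the following statements hold. (I) For almost every $\rho\in\mathbb{R}$, there exist an observable $\Psi\in\mathbb{R}_{\widetilde\Delta}(\mathbb{T})$ and a dense set $\Xi\subset\mathbb{T}$ with $0\in\Xi$ such that for every $\theta\in\Xi$, the following inequality holds for infinitely many $N\in\mathbb{N}^+$: $$\mathbf{Error}_N^{\mathrm{dis}}(w,\Psi,\rho,\theta)\geqslant\frac{1}{4\widetilde\Delta(N)}.$$ Similarly, for almost every $\rho\in\mathbb{R}^2$, there exist an observable $\Phi\in\mathbb{R}_{\widetilde\Delta}(\mathbb{T}^2)$ and a set $\Theta\subset\mathbb{T}^2$ with $(0,0)\in\Theta$ such that for every $\theta\in\Theta$, the following inequality holds for a sequence $T\to+\infty$: $$\mathbf{Error}_T^{\mathrm{con}}(w,\Phi,\rho,\theta)\geqslant\frac{1}{4\widetilde\Delta(T)}.$$ (II) For almost every $\rho\in\mathbb{R}$, there exists an observable $\Psi^*\in\mathbb{R}^2_{\widetilde\Delta}(\mathbb{T})$ such that the following inequality holds for infinitely many $N\in\mathbb{N}^+$: $$\mathbf{Error}_N^{\mathrm{dis}}(w,\Psi^*,\rho,\theta)\geqslant\frac{1}{4\widetilde\Delta(N)},\quad\forall\theta\in\mathbb{T}.$$ Similarly, for almost every $\rho\in\mathbb{R}^2$,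 there exists an observable $\Phi^*\in\mathbb{R}^2_{\widetilde\Delta}(\mathbb{T}^2)$ such that the following inequality holds for a sequence $T\to+\infty$: $$\mathbf{Error}_T^{\mathrm{con}}(w,\Phi^*,\rho,\theta)\geqslant\frac{1}{4\widetilde\Delta(T)},\quad\forall\theta\in\mathbb{T}^2.$$ (III) For almost every $\rho\in\mathbb{R}$ and every $\theta\in\mathbb{T}$, there exists an observable $\Psi_*\in\mathbb{R}_{\widetilde\Delta}(\mathbb{T})$ such that the following inequality holds for infinitely many $N\in\mathbb{N}^+$: $$\mathbf{Error}_N^{\mathrm{dis}}(w,\Psi_*,\rho,\theta)\geqslant\frac{1}{4\widetilde\Delta(N)}.$$ Similarly, for almost every $\rho\in\mathbb{R}^2$ and every $\theta\in\mathbb{T}^2$, there exists an observable $\Phi_*\in\mathbb{R}_{\widetilde\Delta}(\mathbb{T}^2)$ such that the following inequality holds for a sequence $T\to+\infty$: $$\mathbf{Error}_T^{\mathrm{con}}(w,\Phi_*,\rho,\theta)\geqslant\frac{1}{4\widetilde\Delta(T)}.$$ Indeed, the observables in (I) and (III) can be chosen from the space $\mathbb{R}^l_{\widetilde\Delta}(\cdot)$ for any $l\geqslant1$, whereas those in (II) can be chosen from $\mathbb{R}^l_{\widetilde\Delta}(\cdot)$ for any $l\geqslant2$.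
   Context: Notation: $d,l$ are positive integers; $\mathbb{T}^d=\mathbb{R}^d/\mathbb{Z}^d$; $\|\cdot\|_{\ell^\infty}$ is the maximum norm of the components of a vector; $\langle k,x\rangle=\sum_jk_jx_j$; ''almost every'' refers to Lebesgue measure. Rotation: for $\rho\in\mathbb{R}^d$, $s\in\mathbb{R}$, $\theta\in\mathbb{T}^d$, put $\mathscr{T}^s_\rho(\theta)=\theta+s\rho\pmod{\mathbb{Z}^d}$. Approximation function: a continuous, strictly monotonically increasing function $\widetilde\Delta$ with $\widetilde\Delta(1)>0$ and $\widetilde\Delta(+\infty)=+\infty$. Weighting functions: $w$ is a non-negative $C^\infty$ function on $\mathbb{R}$ with $w(x)=0$ for $x\in\mathbb{R}\setminus[0,1]$ and $\int_0^1w(x)\,dx=1$. For $\beta\geqslant1$, $w\in\mathcal{W}_\beta$ means that in addition $D^jw(0)=D^jw(1)=0$ for all $j\geqslant0$, and there exist constants $\bar C,\lambda>0$ with $\|D^mw\|_{L^1(0,1)}\leqslant\bar C\lambda^mm^{m\beta}$ for all $m\in\mathbb{N}^+$. Space of observables: for an approximation function $\widetilde\Delta$, the space $\mathbb{R}^l_{\widetilde\Delta}(\mathbb{T}^d)$ consists of all smooth vector-valued observables $f:\mathbb{T}^d\to\mathbb{R}^l$ with Fourier series $f(\theta)=\sum_{k\in\mathbb{Z}^d}\widehat f(k)\exp(2\pi i\langle k,\theta\rangle)$, $\widehat f(k)=\int_{\mathbb{T}^d}f(x)\exp(-2\pi i\langle k,x\rangle)\,dx$, satisfying $$\|\widehat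 f(k)\|_{\ell^\infty}\leqslant\widetilde\Delta(\|k\|_{\ell^\infty})^{-1}\quad\text{for all }k\in\mathbb{Z}^d\setminus\{0\},\qquad\text{and}\qquad\sum_{k\in\mathbb{Z}^d\setminus\{0\}}\widetilde\Delta(\|k\|_{\ell^\infty})^{-1}<+\infty.$$ Write $\mathbb{R}_{\widetilde\Delta}(\mathbb{T}^d)=\mathbb{R}^1_{\widetilde\Delta}(\mathbb{T}^d)$. Errors of the weighted Birkhoff averages: with $A_N=\sum_{n=0}^{N-1}w(n/N)$, $$\mathbf{Error}_N^{\mathrm{dis}}(w,f,\rho,\theta)=\Big\|\frac1{A_N}\sum_{n=0}^{N-1}w(n/N)f(\mathscr{T}^n_\rho(\theta))-\int_{\mathbb{T}^d}f(x)\,dx\Big\|_{\ell^\infty},$$ $$\mathbf{Error}_T^{\mathrm{con}}(w,f,\rho,\theta)=\Big\|\frac1T\int_0^Tw(s/T)f(\mathscr{T}^s_\rho(\theta))\,ds-\int_{\mathbb{T}^d}f(x)\,dx\Big\|_{\ell^\infty}.$$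
   Formalization: ''Smooth'' means C^r for every r with Σ‖k‖^r/Δ̃(‖k‖)<∞ (so C^∞ if Δ̃ outgrows all polynomials), as C^∞ makes the claim false for polynomial Δ̃; Σ_{k≠0}1/Δ̃(‖k‖)<∞ is assumed on T (discrete) or T² (continuous), as otherwise the space is empty. *)

(* Defs.v *)
From HB Require Import structures.
From mathcomp Require Import all_boot all_order all_algebra.
From mathcomp Require Import all_classical all_reals all_analysis.
From mathcomp Require Export complex.

Set Implicit Arguments.
Unset Strict Implicit.
Unset Printing Implicit Defensive.

Import Order.TTheory GRing.Theory Num.Theory.
Import numFieldNormedType.Exports.

Local Open Scope classical_set_scope.
Local Open Scope ring_scope.
Local Open Scope complex_scope.

(* Points of T^d = R^d/Z^d are represented by vectors of R^d: a function on
   T^d is a Z^d-periodic function on R^d, and a subset of T^d is a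
   Z^d-invariant subset of R^d (it is dense in T^d iff its preimage is dense in
   R^d).  On 'rV, [`|_|] is the maximum norm. *)

Section Torus.
Variables (R : realType) (d : nat).
Implicit Types (k : 'rV[int]_d) (x theta rho : 'rV[R]_d).

Definition lattice k : 'rV[R]_d := map_mx intr k.

Definition periodic (T : Type) (f : 'rV[R]_d -> T) : Prop :=
  forall x k, f (x + lattice k) = f x.

Definition torus_set (A : set 'rV[R]_d) : Prop :=
  forall x k, A x -> A (x + lattice k).

Definition pairing k x : R := \sum_j (k 0 j)%:~R * x 0 j.

Definition rotation rho (s : R) theta : 'rV[R]_d := theta + s *: rho.

End Torus.

Section Integration.
Variable R : realType.

(* Haar integral over T^d, as an iterated Lebesgue integral over [0,1]^d; it is
   only used for continuous functions. *)
Fixpoint torus_integral (d : nat) : ('rV[R]_d -> R) -> R :=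
  match d with
  | 0%N => fun f => f 0
  | d'.+1 => fun f =>
      \int[lebesgue_measure]_(t in `[0, 1])
        torus_integral (fun x : 'rV[R]_d' => f (row_mx (t%:M : 'rV[R]_1) x))
  end.

Definition torus_vintegral (d l : nat) (f : 'rV[R]_d -> 'rV[R]_l) : 'rV[R]_l :=
  \row_i torus_integral (fun x => f x 0 i).

Definition cis (t : R) : R[i] := cos t +i* sin t.

Definition torus_cintegral (d : nat) (g : 'rV[R]_d -> R[i]) : R[i] :=
  torus_integral (fun x => complex.Re (g x))
    +i* torus_integral (fun x => complex.Im (g x)).

Definition fourier (d l : nat) (f : 'rV[R]_d -> 'rV[R]_l) (k : 'rV[int]_d) :
    'rV[R[i]]_l :=
  \row_i torus_cintegral
           (fun x => (f x 0 i)%:C * cis (- (2 * pi * pairing k x))).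

End Integration.

Section Observables.
Variable R : realType.

(* Approximation functions only matter, and are only constrained, on
   [1, +oo). *)
Definition approximation_function (Delta : R -> R) : Prop :=
  [/\ {within `[1, +oo[, continuous Delta},
      {in `[1, +oo[ &, {homo Delta : x y / x < y}},
      0 < Delta 1
    & Delta x @[x --> +oo] --> +oo].

Definition gauge (Delta : R -> R) (d : nat) (k : 'rV[int]_d) : R :=
  (Delta (`|k|%:~R))^-1.

Definition gauge_summable (Delta : R -> R) (d r : nat) : Prop :=
  (\esum_(k in [set k : 'rV[int]_d | (k != 0)%R])
      (`|k|%:~R ^+ r * gauge Delta k)%:E < +oo)%E.

Fixpoint of_class (r d l : nat) (f : 'rV[R]_d -> 'rV[R]_l) : Prop :=
  continuous f /\
  match r with
  | 0%N => True
  | r'.+1 => forall j : 'I_d,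
      (forall x, derivable f x ('e_j)) /\ of_class r' (fun x => 'D_('e_j) f x)
  end.

Definition has_fourier_series (d l : nat) (f : 'rV[R]_d -> 'rV[R]_l) : Prop :=
  forall (theta : 'rV[R]_d) (i : 'I_l),
    (fun n : nat =>
       \sum_(k \in [set k : 'rV[int]_d | `|k| <= n%:Z])
         fourier f k 0 i * cis (2 * pi * pairing k theta)
       : (R[i] : numFieldType))
      @ \oo --> ((f theta 0 i)%:C : (R[i] : numFieldType)).

(* An observable is as smooth as [Delta] forces it to be: it is of class C^r
   whenever the r-times differentiated series of the bounds converges; thus it
   is C^oo if [Delta] outgrows all polynomials, and continuous in all cases.
   Requiring C^oo for a [Delta] of polynomial growth would make weighted
   averages converge faster than any power of N for almost every rotation,
   and no lower bound of order 1/Delta(N) could hold. *)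
Definition observable (Delta : R -> R) (d l : nat)
    (f : 'rV[R]_d -> 'rV[R]_l) : Prop :=
  [/\ periodic f,
      forall r, gauge_summable Delta d r -> of_class r f,
      has_fourier_series f,
      forall k : 'rV[int]_d, k != 0 -> `|fourier f k| <= (gauge Delta k)%:C
    & gauge_summable Delta d 0].

End Observables.

Section WeightedAverages.
Variable R : realType.
Implicit Types (w : R -> R).

Definition weighting_function w : Prop :=
  [/\ forall x, 0 <= w x,
      forall (j : nat) x, derivable (derive1n j w) x 1,
      forall x, x \notin `[0, 1] -> w x = 0
    & (\int[lebesgue_measure]_(x in `[0%R, 1%R]) (w x)%:E = 1)%E].

Definition weight_class (beta : R) w : Prop :=
  [/\ weighting_function w,
      forall j : nat, derive1n j w 0 = 0 /\ derive1n j w 1 = 0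
    & exists C lambda : R, [/\ 0 < C, 0 < lambda
      & forall m : nat, (0 < m)%N ->
          (\int[lebesgue_measure]_(x in `]0%R, 1%R[)
                `|derive1n m w x|%:E
             <= (C * lambda ^+ m * (m%:R `^ (m%:R * beta))%R)%:E)%E]].

Definition weight_sum w (N : nat) : R := \sum_(0 <= n < N) w (n%:R / N%:R).

Definition error_dis (d l : nat) w (f : 'rV[R]_d -> 'rV[R]_l)
    (rho theta : 'rV[R]_d) (N : nat) : R :=
  `| (weight_sum w N)^-1 *:
       (\sum_(0 <= n < N) w (n%:R / N%:R) *: f (rotation rho n%:R theta))
     - torus_vintegral f |.

Definition error_con (d l : nat) w (f : 'rV[R]_d -> 'rV[R]_l)
    (rho theta : 'rV[R]_d) (T : R) : R :=
  `| T^-1 *: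
       (\row_i \int[lebesgue_measure]_(s in `[0, T])
                 (w (s / T) * f (rotation rho s theta) 0 i))
     - torus_vintegral f |.

Definition vec1 (a : R) : 'rV[R]_1 := a%:M.

Definition vec2 (a : R * R) : 'rV[R]_2 := row_mx (vec1 a.1) (vec1 a.2).

End WeightedAverages.

(* Main.v *)
(** The observables are lacunary trigonometric series with amplitudes
    [2 / Delta |k_n|], tested at the times [T_n = |k_n|].

    For almost every rotation there are arbitrarily large [k] for which [|k|]
    times the distance of [<k, rho>] to the integers (to [0] in the continuous
    case) is as small as one wishes: the set of badly approximable numbers has no
    density point.  For such
    [k] the weighted average of the mode [k] over the time [|k|] is almost the
    mode itself.  Hence at time [T_n] the mode [n] contributes about
    [2 / Delta T_n], while
    - the modes [m < n] contribute [o (1 / Delta T_n)]: for a fixed frequency the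
      weighted average decays like [exp (- T ^ sigma)] for every
      [sigma < 1 / beta] (repeated summation or integration by parts, the number
      of steps being optimised against the Gevrey bound on [w]), and
      [Delta T <= exp (T ^ zeta)] with [zeta < 1 / beta];
    - the modes [m > n] are negligible because their amplitudes are, once the
      [k_n] are sparse enough.
    Choosing the phases so that the mode [n] equals its amplitude at a prescribed
    point [theta_n] gives (I) and (III); using [cos] and [sin] of the same phase
    as two components gives a bound uniform in [theta], which is (II). *)

Require Import Defs.
From HB Require Import structures.
From mathcomp Require Import all_boot all_order all_algebra.
From mathcomp Require Import all_classical all_reals all_analysis.
From mathcomp Require Import measurable_realfun.
From mathcomp Require Import ring lra.
Import Order.TTheory GRing.Theory Num.Theory.
Import numFieldNormedType.Exports.
Local Open Scope classical_set_scope.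
Local Open Scope ring_scope.

(** * Dominated series *)

(** The time [|k|] comes from matching two bounds: a coefficient at [k] is at most [1 / Delta |k|],
    while the error at time [N] has to reach [1 / (4 * Delta N)]. The mode must therefore stay
    almost constant along the orbit up to its own norm. This asks for a small multiple of the
    [1 / |k|] of Dirichlet's theorem, whence the restriction to almost every rotation. The
    constants: put [g = 1 / Delta |k n|]. A real cosine of amplitude [2 * g] has coefficients of
    modulus [g] at [k n] and [- k n], the most that is allowed. Where its cosine is at least [1 / 2]
    in absolute value, the mode is worth [g]. Replacing its average by its value costs [2 * g / 8],
    all other modes together cost [g / 2], and [g / 4] is left. The discrete and the continuous case
    differ only in the averaging operator and in what counts as a resonance, so frequencies and
    phases are selected once, for an abstract operator [V] and an abstract map [Omega]. *)

Section DominatedSeries.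
Variable R : realType.
Implicit Types (u v b : nat -> R).

Lemma dominated_series_cvg u b : (forall n, `|u n| <= b n) ->
  cvgn (series b) -> cvgn (series u).
Proof.
move=> ub cb; apply: (@normed_cvg R R^o).
apply: series_le_cvg cb => // n; first exact: normr_ge0.
exact: le_trans (normr_ge0 (u n)) (ub n).
Qed.

Lemma dominated_series_tail u b N : (forall n, `|u n| <= b n) ->
  cvgn (series b) ->
  `|limn (series u) - series u N| <= limn (series b) - series b N.
Proof.
move=> ub cb; have cu := dominated_series_cvg u b ub cb.
have h1 : `|series u M - series u N| @[M --> \oo] -->
    `|limn (series u) - series u N|.
  by apply: cvg_norm; apply: cvgB cu _; exact: cvg_cst.
have h2 : series b M - series b N @[M --> \oo] -->
    limn (series b) - series b N by apply: cvgB cb _; exact: cvg_cst.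
rewrite -(cvg_lim _ h1)// -(cvg_lim _ h2)//.
apply: ler_lim.
- by apply/cvg_ex; eexists; exact: h1.
- by apply/cvg_ex; eexists; exact: h2.
near=> M.
have NM : (N <= M)%N by near: M; exact: nbhs_infty_ge.
by rewrite !sub_series_geq// (le_trans (ler_norm_sum _ _ _))// ler_sum.
Unshelve. all: by end_near. Qed.

Lemma dominated_series_le u b : (forall n, `|u n| <= b n) ->
  cvgn (series b) -> `|limn (series u)| <= limn (series b).
Proof.
move=> ub cb; have := dominated_series_tail u b 0 ub cb.
by rewrite /series/= !big_geq// !subr0.
Qed.

(** Dominated convergence for series along any filter, so that continuity ([nbhs x]) and termwise
    differentiation ([0^']) are two instances. *)
Lemma tannery (T : Type) (F : set_system T) {FF : ProperFilter F}
    (q : nat -> T -> R) (l b : nat -> R) :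
  (forall n t, `|q n t| <= b n) -> cvgn (series b) ->
  (forall n, q n t @[t --> F] --> l n) ->
  limn (series (q^~ t)) @[t --> F] --> limn (series l).
Proof.
move=> qb cb ql.
have lb n : `|l n| <= b n.
  have h : `|q n t| @[t --> F] --> `|l n| by apply: cvg_norm; exact: ql.
  rewrite -(cvg_lim _ h)//; apply: limr_le; last exact: nearW.
  by apply/cvg_ex; eexists; exact: h.
apply/cvgrPdist_lt => e e0.
have e3 : 0 < e / 3 by lra.
have [N _ /(_ N (leqnn N)) /=] := ((cvgrPdist_lt _ _).1 cb) _ e3.
have hN t := dominated_series_tail (q^~ t) b N (qb^~ t) cb.
have hl := dominated_series_tail l b N lb cb.
have b0 : 0 <= limn (series b) - series b N := le_trans (normr_ge0 _) hl.
rewrite ger0_norm// => bN.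
have cN : series (q^~ t) N @[t --> F] --> series l N.
  by apply: cvg_big => [|i _]; [exact: add_continuous|exact: ql].
near=> t.
have h : `|series l N - series (q^~ t) N| < e / 3.
  by near: t; exact: ((cvgrPdist_lt _ _).1 cN).
have := hN t.
move: hl h bN; rewrite !ler_norml !ltr_norml => /andP[? ?] /andP[? ?] ? /andP[? ?].
by apply/andP; split; lra.
Unshelve. all: by end_near. Qed.

Lemma geometric_series_lim (C : R) :
  limn (series (fun n => C / 2 ^+ n.+1)) = C /\
  cvgn (series (fun n => C / 2 ^+ n.+1)).
Proof.
have -> : (fun n => C / 2 ^+ n.+1) = geometric (C / 2) (2^-1).
  by apply/funext => n; rewrite /geometric/= exprS invfM mulrA exprVn.
have h : `|2^-1 : R| < 1 by rewrite ger0_norm; lra.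
have := @cvg_geometric_series R (C / 2) _ h.
have -> : C / 2 * (1 - 2^-1)^-1 = C by field.
by move=> c; split; [exact: cvg_lim|apply/cvg_ex; exists C].
Qed.

(** The weights [1 / 2 ^+ n.+1] add up to 1, so the terms other than [k] contribute at most [C].
    This separates one mode from all others, earlier and later alike. *)
Lemma series_isolated_term u (C : R) (k : nat) :
  (forall n, n != k -> `|u n| <= C / 2 ^+ n.+1) ->
  `|limn (series u) - u k| <= C.
Proof.
move=> uC; pose v n := if n == k then 0 else u n.
(* The erased term is 0, so its bound needs [0 <= C]; any index other than [k] shows it. *)
have C0 : 0 <= C.
  have := uC k.+1; rewrite neq_ltn ltnSn orbT => /(_ isT).
  by move=> /(le_trans (normr_ge0 _)); rewrite pmulr_lge0// invr_gt0 exprn_gt0.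
have [lC cC] := geometric_series_lim C.
have vC n : `|v n| <= C / 2 ^+ n.+1.
  rewrite /v; case: eqVneq => [_|/uC//].
  by rewrite normr0 divr_ge0// exprn_ge0.
have cv := dominated_series_cvg _ _ vC cC.
have : limn (series u) = limn (series v) + u k.
  apply: cvg_lim => //.
  have : series v n + u k @[n --> \oo] --> limn (series v) + u k.
    by apply: cvgD cv _; exact: cvg_cst.
  apply: cvg_trans; apply: near_eq_cvg; near=> n.
  have kn : (k < n)%N by near: n; exact: nbhs_infty_gt.
  rewrite /series/= !big_mkord (bigD1 (Ordinal kn))//= [in RHS](bigD1 (Ordinal kn))//=.
  rewrite {1}/v eqxx add0r addrC; congr (_ + _); apply: eq_bigr => i.
  by rewrite -val_eqE/= /v => /negbTE ->.
move=> ->; rewrite addrK -[leRHS]lC.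
exact: dominated_series_le.
Unshelve. all: by end_near. Qed.

End DominatedSeries.

Lemma series_single_term (R : realType) (u : nat -> R) (k : nat) :
  (forall n, n != k -> u n = 0) -> limn (series u) = u k.
Proof.
move=> u0; apply/eqP; rewrite -subr_eq0 -normr_le0.
by apply: series_isolated_term => n /u0 ->; rewrite normr0 mul0r.
Qed.

(** * Integrals over a segment *)

Section SegmentIntegral.
Variable R : realType.
Implicit Types (f F : R -> R) (a b : R).
Local Notation mu := (@lebesgue_measure R).

Lemma continuous_integrable f a b : continuous f ->
  mu.-integrable `[a, b] (EFin \o f).
Proof.
move=> cf; apply: continuous_compact_integrable; first exact: segment_compact.
exact: continuous_subspaceT.
Qed.

Lemma Rintegral_FTC f F a b : a <= b ->
  (forall x : R, is_derive x 1 F (f x)) -> continuous f ->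
  \int[mu]_(x in `[a, b]) f x = F b - F a.
Proof.
rewrite le_eqVlt => /predU1P[-> _ _|ab dF cf].
  by rewrite subrr set_itv1 Rintegral_set1.
have cF : continuous F.
  move=> x; apply/differentiable_continuous/derivable1_diffP.
  exact: (@ex_derive _ _ _ _ _ _ _ (dF x)).
rewrite /Rintegral (@continuous_FTC2 _ f F)//.
- exact: continuous_subspaceT.
- split.
  + by move=> x _; exact: (@ex_derive _ _ _ _ _ _ _ (dF x)).
  + by apply: cvg_at_right_filter; exact: cF.
  + by apply: cvg_at_left_filter; exact: cF.
- by move=> x _; rewrite derive1E; exact: (@derive_val _ _ _ _ _ _ _ (dF x)).
Qed.

Lemma Rintegral_sum (I : Type) (r : seq I) (P : pred I) (h : I -> R -> R) a b :
  (forall i, continuous (h i)) ->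
  \int[mu]_(x in `[a, b]) (\sum_(i <- r | P i) h i x) =
  \sum_(i <- r | P i) \int[mu]_(x in `[a, b]) h i x.
Proof.
move=> ch; elim: r => [|i r IH].
  rewrite big_nil (eq_Rintegral _ (g := cst 0)); last by move=> x _; rewrite big_nil.
  by rewrite Rintegral_cst// mul0r.
rewrite big_cons -IH; case: ifPn => Pi; last first.
  by apply: eq_Rintegral => x _; rewrite big_cons (negbTE Pi).
rewrite -RintegralD//.
- by apply: eq_Rintegral => x _; rewrite big_cons Pi.
- exact: continuous_integrable.
- apply: continuous_integrable => x.
  by apply: cvg_big => [|j _]; [exact: add_continuous|exact: ch].
Qed.

Lemma Rintegral_segment_cst (c : R) a b : a <= b ->
  \int[mu]_(x in `[a, b]) c = c * (b - a).
Proof.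
move=> ab; rewrite Rintegral_cst//; congr (_ * _).
have -> : fine (mu `[a, b]%classic) = b - a; last by [].
rewrite lebesgue_measure_itv/= lte_fin.
by move: ab; rewrite le_eqVlt => /predU1P[->|->]//; rewrite ltxx subrr.
Qed.

Lemma normr_Rintegral_le f a b (M : R) : a <= b -> continuous f ->
  (forall x, a <= x <= b -> `|f x| <= M) ->
  `|\int[mu]_(x in `[a, b]) f x| <= M * (b - a).
Proof.
move=> ab cf fM.
rewrite -Rintegral_segment_cst//.
apply: (le_trans (le_normr_Rintegral _ _)) => //; first exact: continuous_integrable.
apply: le_Rintegral => //.
- apply: (@continuous_integrable (fun x => `|f x|)) => x.
  by apply: cvg_norm; exact: cf.
- by apply: (@continuous_integrable (cst M)) => x; exact: cvg_cst.
Qed.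

Lemma lipschitz_of_derive F f (M x y : R) :
  (forall x : R, is_derive x 1 F (f x)) -> continuous f ->
  (forall x, `|f x| <= M) -> `|F x - F y| <= M * `|x - y|.
Proof.
move=> dF cf fM; wlog yx : x y / y <= x => [H|].
  by have /orP[/H|/H//] := le_total x y; rewrite (distrC (F y)) (distrC y).
rewrite -(Rintegral_FTC _ _ _ _ yx dF cf) (ger0_norm (_ : 0 <= x - y)) ?subr_ge0//.
exact: normr_Rintegral_le.
Qed.

Lemma dominated_series_continuous (T : topologicalType) (h : nat -> T -> R)
    (B : nat -> R) :
  (forall n, continuous (h n)) -> (forall n x, `|h n x| <= B n) ->
  cvgn (series B) -> continuous (fun x => limn (series (h^~ x))).
Proof.
by move=> ch hB cB x; apply: (@tannery R T (nbhs x) _ h _ B) => // n; exact: ch.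
Qed.

Lemma Rintegral_dominated_series (h : nat -> R -> R) (B : nat -> R) a b :
  a <= b -> (forall n, continuous (h n)) -> (forall n x, `|h n x| <= B n) ->
  cvgn (series B) ->
  \int[mu]_(x in `[a, b]) limn (series (h^~ x)) =
  limn (series (fun n => \int[mu]_(x in `[a, b]) h n x)).
Proof.
move=> ab ch hB cB; apply/esym/cvg_lim => //.
have cS := dominated_series_continuous _ h B ch hB cB.
have cSN N : continuous (fun x => series (h^~ x) N).
  move=> x; rewrite /series/=.
  by apply: cvg_big => [|j _]; [exact: add_continuous|exact: ch].
apply/cvgrPdist_le => e e0.
(* Adding 1 keeps the divisor positive when [a = b]. *)
have ba : 0 < e / (b - a + 1) by apply: divr_gt0 => //; lra.
near=> N.
rewrite /series/= -Rintegral_sum// -RintegralB//; last 2 first.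
- exact: (continuous_integrable _ _ _ cS).
- exact: (continuous_integrable _ _ _ (cSN N)).
apply: le_trans (_ : e / (b - a + 1) * (b - a) <= _).
  apply: normr_Rintegral_le => //.
    by move=> x; apply: cvgB; [exact: cS|exact: cSN].
  move=> x _; apply: le_trans (dominated_series_tail _ (h^~ x) B N _ cB) _ => //.
  apply: le_trans (ler_norm _) _; near: N.
  exact: ((cvgrPdist_le _ _).1 cB).
rewrite mulrAC ler_pdivrMr; last by lra.
by rewrite ler_wpM2l ?(ltW e0)//; lra.
Unshelve. all: by end_near. Qed.

End SegmentIntegral.

(** * Periodicity, derivatives and integrals of cosines *)

Section Trigonometry.
Variable R : realType.
Implicit Types (x y : R) (m : int).

Lemma cosDz x m : cos (x + 2 * pi * m%:~R) = cos x.
Proof.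
have h n : cos (x + 2 * pi * n%:R) = cos x.
  rewrite (_ : 2 * pi * n%:R = (pi *+ 2) *+ n); first exact: periodicn (@cosD2pi R) n x.
  by rewrite -mulrnA -[RHS]mulr_natr natrM; ring.
case: m => n; first exact: h.
rewrite NegzE mulrNz mulrN -[RHS]cosN -(cosN (x - _)) opprB addrC.
rewrite -(periodicn (@cosD2pi R) n.+1 (- x)); congr cos.
by rewrite -mulrnA -[pi *+ _]mulr_natr natrM/= pmulrn; ring.
Qed.

Lemma sinDz x m : sin (x + 2 * pi * m%:~R) = sin x.
Proof. by rewrite -!cosBpihalf addrAC cosDz. Qed.

Lemma is_derive_affine_cos (a b x : R) :
  is_derive x 1 (fun t => cos (a * t + b)) (- a * sin (a * x + b)).
Proof.
have d : is_derive x 1 (fun t : R => a * t + b) a.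
  by apply: is_derive_eq; rewrite addr0 /GRing.scale/= mulr1.
have := @is_derive1_comp R cos (fun t : R => a * t + b) x _ _ (is_derive_cos _) d.
by rewrite mulrC mulrN mulNr.
Qed.

Lemma is_derive_affine_sin (a b x : R) :
  is_derive x 1 (fun t => sin (a * t + b)) (a * cos (a * x + b)).
Proof.
have d : is_derive x 1 (fun t : R => a * t + b) a.
  by apply: is_derive_eq; rewrite addr0 /GRing.scale/= mulr1.
have := @is_derive1_comp R sin (fun t : R => a * t + b) x _ _ (is_derive_sin _) d.
by rewrite mulrC.
Qed.

Lemma continuous_affine_cos (a b : R) : continuous (fun t : R => cos (a * t + b)).
Proof.
move=> x; apply/differentiable_continuous/derivable1_diffP.
exact: (@ex_derive _ _ _ _ _ _ _ (is_derive_affine_cos a b x)).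
Qed.

Lemma Rintegral_cos_period m (b : R) :
  \int[lebesgue_measure]_(t in `[0, 1]) cos (2 * pi * m%:~R * t + b) =
  if m == 0 then cos b else 0.
Proof.
case: eqVneq => [->|m0].
  under eq_Rintegral do rewrite mulr0z mulr0 mul0r add0r.
  by rewrite Rintegral_segment_cst// subr0 mulr1.
set a := 2 * pi * _.
have a0 : a != 0 by rewrite !mulf_neq0 ?intr_eq0// gt_eqF// pi_gt0.
have d (x : R) : is_derive x 1 (fun t => a^-1 * sin (a * t + b)) (cos (a * x + b)).
  have d := is_derive_affine_sin a b x.
  by apply: is_derive_eq; rewrite /GRing.scale/= mulKf.
rewrite (@Rintegral_FTC R _ _ 0 1 ler01 d); last exact: continuous_affine_cos.
by rewrite mulr1 mulr0 add0r (addrC a) (_ : sin (b + a) = sin b) ?subrr// sinDz.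
Qed.

End Trigonometry.

(** * Trigonometric series on the torus *)

Lemma normr_coord_le (K : realDomainType) d (x : 'rV[K]_d) j : `|x 0 j| <= `|x|.
Proof.
rewrite [leRHS]/Num.Def.normr/= mx_normrE.
exact: (le_bigmax _ (fun i => `|x i.1 i.2|) (0, j)).
Qed.

Lemma normr_row_le (K : realDomainType) d (x : 'rV[K]_d) (M : K) : 0 <= M ->
  (forall j, `|x 0 j| <= M) -> `|x| <= M.
Proof.
move=> M0 xM; rewrite [leLHS]/Num.Def.normr/= mx_normrE.
by apply: bigmax_le => // -[i j] _ /=; rewrite (ord1 i).
Qed.

Section Pairing.
Variables (R : realType) (d : nat).
Implicit Types (k : 'rV[int]_d) (x : 'rV[R]_d).

Lemma pairingDr k x y : pairing k (x + y) = pairing k x + pairing k y.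
Proof. by rewrite /pairing -big_split; apply: eq_bigr => j _; rewrite mxE mulrDr. Qed.

Lemma pairingZr k (s : R) x : pairing k (s *: x) = s * pairing k x.
Proof.
by rewrite /pairing mulr_sumr; apply: eq_bigr => j _; rewrite mxE mulrCA.
Qed.

Lemma pairingDl k k' x : pairing (k + k') x = pairing k x + pairing k' x.
Proof.
by rewrite /pairing -big_split; apply: eq_bigr => j _; rewrite mxE intrD mulrDl.
Qed.

Lemma pairingNl k x : pairing (- k) x = - pairing k x.
Proof.
by rewrite /pairing -sumrN; apply: eq_bigr => j _; rewrite mxE mulrNz mulNr.
Qed.

Lemma pairing_lattice k k' :
  pairing k (lattice R k') = (\sum_j k 0 j * k' 0 j)%:~R.
Proof.
by rewrite /pairing rmorph_sum; apply: eq_bigr => j _; rewrite mxE/= rmorphM.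
Qed.

Lemma pairing_delta k j : pairing k ('e_j : 'rV[R]_d) = (k 0 j)%:~R.
Proof.
rewrite /pairing (bigD1 j)//= big1 ?mxE ?eqxx ?mulr1 ?addr0// => i ij.
by rewrite mxE eqxx/= (negbTE ij) mulr0.
Qed.

Lemma pairing_continuous k : continuous (pairing k : 'rV[R]_d -> R).
Proof.
apply: continuous_big => [|j _ x]; first exact: add_continuous.
apply: continuousM; first exact: cst_continuous.
exact: (@coord_continuous R 1 d 0 j).
Qed.

Lemma normr_int_ge1 k : k != 0 -> 1 <= `|k|%:~R :> R.
Proof. by move=> k0; rewrite ler1z -gtz0_ge1 normr_gt0. Qed.

End Pairing.

Lemma pairing_row_mx (R : realType) d (k : 'rV[int]_d.+1) (t : R) (x : 'rV[R]_d) :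
  pairing k (row_mx (t%:M : 'rV[R]_1) x : 'rV[R]_d.+1) =
  (k 0 0)%:~R * t + pairing (\row_j k 0 (lift ord0 j)) x.
Proof.
rewrite /pairing big_ord_recl; congr (_ + _).
  have -> : row_mx (t%:M : 'rV[R]_1) x 0 (ord0 : 'I_d.+1) = t.
    transitivity ((t%:M : 'rV[R]_1) 0 0); last by rewrite mxE eqxx mulr1n.
    rewrite -(row_mxEl (t%:M : 'rV[R]_1) x 0 0); congr (row_mx _ _ _ _).
    exact: val_inj.
  by [].
apply: eq_bigr => j _; rewrite mxE; congr (_ * _).
rewrite -(row_mxEr (t%:M : 'rV[R]_1) x 0 j); congr (row_mx _ _ _ _).
exact: val_inj.
Qed.

(** The integral is iterated, so the induction on [d] integrates the first coordinate last.
    Arbitrary phases are needed because the first coordinate enters the modes of the remaining ones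
    as a phase. The finite index [I] leaves room for the two cosines into which a product of cosines
    splits. *)
Lemma torus_integral_trig (R : realType) d (I : finType) (b : nat -> I -> R)
    (m : nat -> I -> 'rV[int]_d) (psi : nat -> I -> R) (B : nat -> R) :
  (forall n i, `|b n i| <= B n) -> cvgn (series B) ->
  torus_integral (fun x : 'rV[R]_d => limn (series (fun n =>
    \sum_i b n i * cos (2 * pi * pairing (m n i) x + psi n i)))) =
  limn (series (fun n =>
    \sum_(i | m n i == 0) b n i * cos (psi n i))).
Proof.
move=> bB cB.
elim: d m psi => [|d IH] m psi.
  rewrite /=; congr (limn (series _)); apply/funext => n.
  apply: eq_big => [i|i _]; first by rewrite thinmx0 eqxx.
  by rewrite /pairing big_ord0 mulr0 add0r.
pose m' n i := \row_j m n i 0 (lift ord0 j).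
have m0E n i : (m n i == 0) = (m' n i == 0) && (m n i 0 0 == 0).
  apply/eqP/andP => [e|[/eqP m'0 /eqP m00]].
    by split; [apply/eqP/rowP => j; rewrite !mxE e mxE|rewrite e mxE].
  apply/rowP => j; rewrite mxE; case: (unliftP ord0 j) => [j' ->|->//].
  by move/rowP : m'0 => /(_ j'); rewrite !mxE.
(* What survives the inner integral: the modes that depend on the first coordinate alone. *)
pose h n t := \sum_(i | m' n i == 0)
  b n i * cos (2 * pi * (m n i 0 0)%:~R * t + psi n i).
have ch n : continuous (h n).
  move=> t; apply: cvg_big => [|i _]; first exact: add_continuous.
  by apply: cvgM; [exact: cvg_cst|exact: continuous_affine_cos].
transitivity (\int[lebesgue_measure]_(t in `[0, 1]) limn (series (h^~ t))).
  apply: eq_Rintegral => t _.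
  rewrite /h -(IH m' (fun n i => 2 * pi * (m n i 0 0)%:~R * t + psi n i)).
  congr torus_integral; apply/funext => x; congr (limn (series _)).
  apply/funext => n; apply: eq_bigr => i _; rewrite pairing_row_mx.
  by congr (_ * cos _); ring.
rewrite (@Rintegral_dominated_series R h (fun n => #|I|%:R * B n))//; first last.
- exact: is_cvg_seriesZ.
- move=> n t; apply: le_trans (ler_norm_sum _ _ _) _.
  apply: le_trans (_ : \sum_(i : I) B n <= _); last first.
    by rewrite sumr_const mulr_natl.
  rewrite big_mkcond; apply: ler_sum => i _.
  have B0 := le_trans (normr_ge0 _) (bB n i).
  by case: ifP => // _; rewrite normrM -[leRHS]mulr1 ler_pM// cos_max.
congr (limn (series _)); apply/funext => n; rewrite /h Rintegral_sum; last first.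
  by move=> i t; apply: cvgM; [exact: cvg_cst|exact: continuous_affine_cos].
rewrite [LHS]big_mkcond [RHS]big_mkcond; apply: eq_bigr => i _; rewrite m0E.
case: ifP => //= _.
rewrite RintegralZl//; last first.
  by apply: continuous_integrable; exact: continuous_affine_cos.
by rewrite Rintegral_cos_period; case: ifP; rewrite ?mulr0.
Qed.

Section TrigSeries.
Variables (R : realType) (d : nat).
Implicit Types (a phi : nat -> R) (k : nat -> 'rV[int]_d) (x : 'rV[R]_d).

Definition trig_series a k phi x : R :=
  limn (series (fun n => a n * cos (2 * pi * pairing (k n) x + phi n))).

Lemma normr_mul_cos_le (b t : R) : `|b * cos t| <= `|b|.
Proof. by rewrite normrM -[leRHS]mulr1 ler_pM// cos_max. Qed.

Lemma cos_lipschitz (s t : R) : `|cos s - cos t| <= `|s - t|.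
Proof.
rewrite -[leRHS]mul1r; apply: lipschitz_of_derive (@is_derive_cos R) _ _ => u.
  by apply: cvgN; exact: continuous_sin.
by rewrite normrN sin_max.
Qed.

Lemma trig_series_periodic a k phi : Defs.periodic (trig_series a k phi).
Proof.
move=> x k'; rewrite /trig_series; congr (limn (series _)); apply/funext => n.
by rewrite pairingDr pairing_lattice mulrDr addrAC cosDz.
Qed.

Section Summable.
Variables (a : nat -> R) (k : nat -> 'rV[int]_d) (phi : nat -> R).
Hypothesis ca : cvgn (series (fun n => `|a n|)).

Lemma trig_series_continuous : continuous (trig_series a k phi).
Proof.
apply: dominated_series_continuous ca => [n|n x]; last exact: normr_mul_cos_le.
move=> x; apply: continuousM; first exact: cst_continuous.
apply: continuous_comp; last exact: continuous_cos.
apply: continuousD; last exact: cst_continuous.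
by apply: continuousM; [exact: cst_continuous|exact: pairing_continuous].
Qed.

(* The two products are [cos u * cos v = (cos (u + v) + cos (u - v)) / 2] *)
Lemma torus_integral_trig_mul (k' : 'rV[int]_d) (c : R) :
  torus_integral (fun x => trig_series a k phi x * cos (2 * pi * pairing k' x + c)) =
  limn (series (fun n => a n / 2 *
    ((if k n + k' == 0 then cos (phi n + c) else 0) +
     (if k n - k' == 0 then cos (phi n - c) else 0)))).
Proof.
pose m n (s : bool) := if s then k n + k' else k n - k'.
pose psi n (s : bool) := if s then phi n + c else phi n - c.
rewrite (_ : (fun x => _ * _) = (fun x => limn (series (fun n =>
    \sum_(s : bool) a n / 2 * cos (2 * pi * pairing (m n s) x + psi n s))))).
  rewrite (torus_integral_trig _ _ _ _ m psi (fun n => `|a n|)) => [|n _|//].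
    congr (limn (series _)); apply/funext => n.
    by rewrite big_mkcond big_bool/= mulrDr; congr (_ + _); case: ifP; rewrite ?mulr0.
  rewrite normrM ler_piMr// ger0_norm ?invr_ge0//; lra.
apply/funext => x; rewrite /trig_series mulrC.
have cT : cvgn (series (fun n => a n * cos (2 * pi * pairing (k n) x + phi n))).
  by apply: dominated_series_cvg ca => n; exact: normr_mul_cos_le.
have := lim_seriesZ (cos (2 * pi * pairing k' x + c)) cT.
rewrite /GRing.scale/= => <-; congr (limn (series _)).
apply/funext => n; rewrite big_bool/= /GRing.scale/=.
rewrite !pairingDl pairingNl.
set u := 2 * pi * pairing (k n) x + phi n; set v := 2 * pi * pairing k' x + c.
rewrite (_ : 2 * pi * (_ + _) + _ = u + v); last by rewrite /u /v; ring.
rewrite (_ : 2 * pi * (_ - _) + _ = u - v); last by rewrite /u /v; ring.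
by rewrite -/v (cosD u) cosB; field.
Qed.

End Summable.

End TrigSeries.

Local Open Scope complex_scope.

(** * Fourier coefficients of a lacunary cosine series *)

Section Fourier.
Variables (R : realType) (d l : nat).
Variables (a : nat -> R) (k : nat -> 'rV[int]_d) (phi : nat -> 'I_l -> R).
Hypothesis ca : cvgn (series (fun n => `|a n|)).
Hypothesis k0 : forall n, k n != 0.
Hypothesis kincr : forall m n, (m < n)%N -> `|k m| < `|k n|.

Definition trig_observable (x : 'rV[R]_d) : 'rV[R]_l :=
  \row_i trig_series R d a k (phi^~ i) x.

Let f := trig_observable.

Lemma freq_norm_inj m n : `|k m| = `|k n| -> m = n.
Proof. by move=> e; case: (ltngtP m n) => // /kincr; rewrite e ltxx. Qed.

Lemma freq_inj : injective k.
Proof. by move=> m n e; apply: freq_norm_inj; rewrite e. Qed.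

(** Equal norms force [m = n], and then [2 * k n = 0]. Hence each Fourier coefficient comes from at
    most one mode. *)
Lemma freq_neq_opp m n : k m != - k n.
Proof.
apply/negP => /eqP e; have mn : m = n by apply: freq_norm_inj; rewrite e normrN.
move: e (k0 n); rewrite mn => /rowP e /negP; apply; apply/eqP/rowP => j.
by have/eqP := e j; rewrite !mxE -addr_eq0 -mulr2n mulrn_eq0 => /eqP.
Qed.

(** The imaginary part of the kernel is minus a sine, that is, a cosine shifted by [pi / 2]. Both
    parts are thus [torus_integral_trig_mul], with [c = 0] and [c = pi / 2]. *)
Lemma fourierE (k' : 'rV[int]_d) i : fourier f k' 0 i =
  limn (series (fun n => a n / 2 *
    ((if k n == - k' then cos (phi n i) else 0) +
     (if k n == k' then cos (phi n i) else 0)))) +i*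
  limn (series (fun n => a n / 2 *
    ((if k n == - k' then cos (phi n i + pi / 2) else 0) +
     (if k n == k' then cos (phi n i - pi / 2) else 0)))).
Proof.
rewrite /fourier mxE /torus_cintegral; congr (_ +i* _).
  transitivity (torus_integral (fun x =>
      trig_series R d a k (phi^~ i) x * cos (2 * pi * pairing k' x + 0))).
    congr torus_integral; apply/funext => x.
    by rewrite /f mxE /cis /= cosN mul0r subr0 addr0.
  rewrite torus_integral_trig_mul//; congr (limn (series _)); apply/funext => n.
  by rewrite addr_eq0 subr_eq0 addr0 subr0.
transitivity (torus_integral (fun x =>
    trig_series R d a k (phi^~ i) x * cos (2 * pi * pairing k' x + pi / 2))).
  congr torus_integral; apply/funext => x.
  by rewrite /f mxE /cis /= sinN mul0r addr0 cosDpihalf.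
rewrite torus_integral_trig_mul//; congr (limn (series _)); apply/funext => n.
by rewrite addr_eq0 subr_eq0.
Qed.

Lemma fourier_freq n i : fourier f (k n) 0 i = (a n / 2)%:C * cis (phi n i).
Proof.
rewrite fourierE (series_single_term _ _ n) => [|m mn]; last first.
  by rewrite (negbTE (freq_neq_opp _ _)) (inj_eq freq_inj) (negbTE mn) addr0 mulr0.
rewrite (series_single_term _ _ n) => [|m mn]; last first.
  by rewrite (negbTE (freq_neq_opp _ _)) (inj_eq freq_inj) (negbTE mn) addr0 mulr0.
rewrite (negbTE (freq_neq_opp _ _)) eqxx !add0r cosBpihalf.
by apply/eqP; rewrite eq_complex /= !mul0r subr0 addr0 !eqxx.
Qed.

Lemma fourier_freqN n i : fourier f (- k n) 0 i = (a n / 2)%:C * cis (- phi n i).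
Proof.
rewrite fourierE (series_single_term _ _ n) => [|m mn]; last first.
  by rewrite opprK (negbTE (freq_neq_opp _ _)) (inj_eq freq_inj) (negbTE mn) addr0 mulr0.
rewrite (series_single_term _ _ n) => [|m mn]; last first.
  by rewrite opprK (negbTE (freq_neq_opp _ _)) (inj_eq freq_inj) (negbTE mn) addr0 mulr0.
rewrite opprK (negbTE (freq_neq_opp _ _)) eqxx !addr0 cosDpihalf.
by apply/eqP; rewrite eq_complex /= cosN sinN !mul0r subr0 addr0 !eqxx.
Qed.

Lemma fourier_eq0 k' i : (forall n, k n != k') -> (forall n, k n != - k') ->
  fourier f k' 0 i = 0.
Proof.
move=> kk' kNk'; rewrite fourierE.
by rewrite !(series_single_term _ _ 0%N) => [|n _|n _];
  rewrite ?(negbTE (kk' _)) ?(negbTE (kNk' _)) ?addr0 ?mulr0.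
Qed.

(** The mean is the coefficient at frequency 0, which no mode has. The errors thus reduce to norms
    of averages. *)
Lemma torus_vintegral_trig_observable : torus_vintegral f = 0.
Proof.
apply/rowP => i; rewrite !mxE.
have := fourier_eq0 0 i k0; rewrite oppr0 => /(_ k0).
rewrite /fourier mxE /torus_cintegral => /eqP; rewrite eq_complex => /andP[/eqP h _].
rewrite -[RHS]h; congr torus_integral; apply/funext => x /=.
have -> : pairing 0 x = 0 by rewrite /pairing big1// => j _; rewrite mxE mul0r.
by rewrite mulr0 oppr0 cos0 mul0r subr0 mulr1.
Qed.

(** The hypothesis compares norms only, so that it covers [k'] and [- k'] at once. *)
Lemma fourier_norm_le (k' : 'rV[int]_d) (M : R) : 0 <= M ->
  (forall n, `|k n| = `|k'| -> `|a n| / 2 <= M) -> `|fourier f k'| <= M%:C.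
Proof.
move=> M0 aM.
have cis1 t : `|cis t| = 1 :> R[i] by rewrite normc_def/= cos2Dsin2 sqrtr1.
have aMC n : `|k n| = `|k'| -> `|(a n / 2)%:C| <= M%:C :> R[i].
  move=> /aM; rewrite normc_def/= expr0n/= addr0 sqrtr_sqr lecR.
  by rewrite normrM (ger0_norm (_ : 0 <= 2^-1)) ?invr_ge0.
have M0C : 0 <= M%:C :> R[i] by rewrite lecR.
(* Complex entries are not totally ordered, so the norm is handled through a coordinate where it is
   attained. *)
have -> : `|fourier f k'| = mx_norm (fourier f k') by [].
have [->//|/mx_norm_neq0[[i j] ->]] := eqVneq (mx_norm (fourier f k')) 0.
rewrite /= (ord1 i).
have [[n e]|nk'] := pselect (exists n, k n = k').
  by rewrite -e fourier_freq normrM cis1 mulr1 aMC// e.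
have [[n e]|nk'N] := pselect (exists n, - k n = k').
  by rewrite -e fourier_freqN normrM cis1 mulr1 aMC// -e normrN.
rewrite fourier_eq0 ?normr0// => n; apply/eqP.
  by move=> e; apply: nk'; exists n.
by move=> e; apply: nk'N; exists n; rewrite e opprK.
Qed.

(** Since the norms increase strictly, a cube of frequencies contains exactly the first few modes
    together with their opposites. The partial sums over cubes are therefore partial sums of the
    cosine series. *)
Lemma trig_observable_fourier_series : has_fourier_series f.
Proof.
move=> theta i.
pose t n := a n * cos (2 * pi * pairing (k n) theta + phi n i).
have ct : cvgn (series t).
  by apply: dominated_series_cvg ca => n; exact: normr_mul_cos_le.
have kge n : n%:Z <= `|k n|.
  elim: n => [|n IH]; first exact: normr_ge0.
  by rewrite intS addrC lezD1 (le_lt_trans IH)// kincr.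
have exM (N : nat) : exists m, ~~ (`|k m| <= N%:Z).
  by exists N.+1; rewrite -ltNge; apply: lt_le_trans (kge N.+1); rewrite ltz_nat.
(* The number of modes of norm at most [N], found as the first index beyond them. *)
pose M N := ex_minn (exM N).
have ltM m N : (m < M N)%N = (`|k m| <= N%:Z).
  rewrite /M; case: ex_minnP => q qN qmin; apply/idP/idP => [mq|kmN].
    by apply/negPn/negP => /qmin; rewrite leqNgt mq.
  rewrite ltnNge; apply/negP => qm; move: qN; apply/negP/negPn.
  by move: qm; rewrite leq_eqVlt => /predU1P[->//|/kincr/ltW/le_trans]; apply.
pose s (N : nat) := map k (iota 0 (M N)) ++ map (-%R \o k) (iota 0 (M N)).
have partial N : \sum_(k' \in [set k' : 'rV[int]_d | `|k'| <= N%:Z])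
    fourier f k' 0 i * cis (2 * pi * pairing k' theta) = (series t (M N))%:C.
  have us : uniq (s N).
    rewrite cat_uniq !map_inj_uniq ?iota_uniq/= ?andbT; last exact: freq_inj.
      by apply/hasPn => _ /mapP[n _ ->]; apply/mapP => -[m _] /eqP;
        rewrite /= eq_sym (negbTE (freq_neq_opp _ _)).
    by move=> m n /oppr_inj; exact: freq_inj.
  have sN x : x \in s N -> `|x| <= N%:Z.
    by rewrite mem_cat => /orP[] /mapP[m]; rewrite mem_iota add0n ltM => /andP[_ ?] ->;
      rewrite /= ?normrN.
  rewrite (fsbigE (s N) _ us)//; last first.
    move=> x /= xN; rewrite mem_cat negb_or => /andP[/mapP xk /mapP xNk].
    rewrite fourier_eq0 ?mul0r// => n; apply/negP => /eqP e.
      by apply: xk; exists n => //; rewrite mem_iota add0n leq0n ltM e.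
    apply: xNk; exists n; last by rewrite /= e opprK.
    by rewrite mem_iota add0n leq0n ltM e normrN.
  rewrite big_mkcond/= (eq_big_seq (fun x =>
    fourier f x 0 i * cis (2 * pi * pairing x theta))); last first.
    by move=> x /sN xN; rewrite mem_set.
  rewrite /s big_cat/= !big_map -big_split/= /series/= rmorph_sum /index_iota subn0.
  apply: eq_bigr => m _; rewrite fourier_freq fourier_freqN pairingNl.
  set u := 2 * pi * pairing (k m) theta.
  rewrite (_ : 2 * pi * - _ = - u); last by rewrite /u; ring.
  rewrite /t -/u; apply/eqP; rewrite eq_complex /= !mul0r !subr0 !addr0.
  by rewrite !cosN !sinN cosD; apply/andP; split; apply/eqP; field.
suff : (fun N => (series t (M N))%:C : (R[i] : numFieldType)) @ \oo -->
    ((f theta 0 i)%:C : (R[i] : numFieldType)).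
  by apply: cvg_trans; apply: near_eq_cvg; apply: nearW => N; exact/esym/partial.
(* A positive element of [R[i]] is a positive real. *)
apply/cvgrPdist_lt => e; case: e => er ei; rewrite ltcE/= => /andP[/eqP -> er0].
have [m0 _ hm0] := (cvgrPdist_lt _ _).1 ct _ er0.
exists (absz `|k m0|) => // N /= kN.
have /hm0 : (m0 <= M N)%N.
  by rewrite ltnW// ltM; move: kN; rewrite -lez_nat gez0_abs.
rewrite /= mxE -/t /trig_series -rmorphB/= normc_def/= expr0n/= addr0 sqrtr_sqr.
by rewrite ltcR.
Qed.

End Fourier.

Local Close Scope complex_scope.

Lemma continuous_row (R : realType) (T : topologicalType) (l : nat)
    (f : T -> 'rV[R]_l) :
  (forall i, continuous (fun x => f x 0 i)) -> continuous f.
Proof.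
move=> cf x; apply/cvgrPdist_le => e e0; near=> y.
rewrite /Num.Def.normr/= mx_normrE (bigmax_le _ (ltW e0))//= => i _.
rewrite !mxE (ord1 i.1); move: i; near: y; apply: filter_forall => /= i.
exact: ((cvgrPdist_le _ _).1 (cf i.2 x)).
Unshelve. all: by end_near. Qed.

(** * Termwise differentiation *)

Section Smoothness.
Variables (R : realType) (d l : nat) (k : nat -> 'rV[int]_d).
Hypothesis k0 : forall n, k n != 0.

(** The difference quotients are dominated because the cosine is 1-Lipschitz. The derivative is
    again a [trig_series], with phases advanced by [pi / 2], so the result can be iterated. *)
Lemma trig_series_derive (a phi : nat -> R) (j : 'I_d) (x : 'rV[R]_d) :
  cvgn (series (fun n => `|a n| * `|k n|%:~R)) ->
  h^-1 *: (trig_series R d a k phi (h *: 'e_j + x) - trig_series R d a k phi x)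
    @[h --> 0^'] -->
  trig_series R d (fun n => 2 * pi * (k n 0 j)%:~R * a n) k
    (fun n => phi n + pi / 2) x.
Proof.
move=> ck.
have ca : cvgn (series (fun n => `|a n|)).
  apply: series_le_cvg ck => n; first exact: normr_ge0.
    by apply: mulr_ge0; rewrite ?ler0z.
  by rewrite ler_peMr// normr_int_ge1.
have ct y : cvgn (series (fun n => a n * cos (2 * pi * pairing (k n) y + phi n))).
  by apply: dominated_series_cvg ca => n; exact: normr_mul_cos_le.
pose A n := 2 * pi * pairing (k n) x + phi n.
pose w n : R := 2 * pi * (k n 0 j)%:~R.
pose q n (h : R) := h^-1 * (a n * (cos (w n * h + A n) - cos (A n))).
have qE h : h^-1 *: (trig_series R d a k phi (h *: 'e_j + x) - trig_series R d a k phi x)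
    = limn (series (q^~ h)).
  rewrite /trig_series -lim_seriesB// -lim_seriesZ; last exact: is_cvg_seriesB.
  congr (limn (series _)); apply/funext => n; rewrite /q -mulrBr /=.
  congr (_ * (_ * (cos _ - _))).
  by rewrite pairingDr pairingZr pairing_delta /A /w; ring.
under eq_fun do rewrite qE.
have pi0 : 0 < pi :> R := pi_gt0 R.
apply: (@tannery R R 0^' _ q _ (fun n => 2 * pi * (`|a n| * `|k n|%:~R))).
(* [tannery] wants the bound for every [h]; at [h = 0] the quotient is 0 by convention. *)
- move=> n h; rewrite /q; have [->|h0] := eqVneq h 0.
    by rewrite invr0 mul0r normr0 !mulr_ge0 ?ler0z// ltW.
  have hc : `|cos (w n * h + A n) - cos (A n)| <= 2 * pi * `|k n|%:~R * `|h|.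
    apply: le_trans (cos_lipschitz _ _ _) _; rewrite addrK /w !normrM.
    rewrite (ger0_norm (ltW pi0)) (ger0_norm (ler0n _ 2)) ler_wpM2r//.
    rewrite ler_wpM2l ?mulr_ge0 ?(ltW pi0)//.
    by rewrite -intr_norm ler_int; exact: normr_coord_le.
  rewrite !normrM normfV ler_pdivrMl ?normr_gt0//.
  apply: le_trans (ler_wpM2l (normr_ge0 _) hc) _.
  by rewrite le_eqVlt; apply/orP; left; apply/eqP; ring.
- exact: is_cvg_seriesZ.
- move=> n.
  have d1 := is_derive_affine_cos R (w n) (A n) 0.
  have d2 : is_derive (0 : R) 1 (fun t : R => a n * cos (w n * t + A n))
      (a n * (- w n * sin (w n * 0 + A n))) by apply: is_derive_eq.
  have c := @ex_derive _ _ _ _ _ _ _ d2; have vE := @derive_val _ _ _ _ _ _ _ d2.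
  rewrite (_ : _ * cos _ = 'D_1 (fun t : R => a n * cos (w n * t + A n)) 0).
    apply: cvg_trans c; apply: near_eq_cvg; apply: nearW => h /=.
    by rewrite /q addr0 mulr0 add0r -mulrBr /GRing.scale/= mulr1.
  by rewrite vE mulr0 add0r addrA cosDpihalf /w /A; ring.
Qed.

(** A derivative multiplies the amplitude of mode [n] by at most [2 * pi * |k n|], and so uses up
    one power of the weight in the hypothesis. *)
Lemma trig_observable_of_class r (a : nat -> R) (phi : nat -> 'I_l -> R) :
  cvgn (series (fun n => `|a n| * `|k n|%:~R ^+ r)) ->
  of_class r (trig_observable R d l a k phi).
Proof.
have coord b psi i : (fun x => trig_observable R d l b k psi x 0 i) =
    trig_series R d b k (psi^~ i) by apply/funext => x; rewrite mxE.
have cont r' (b : nat -> R) psi : cvgn (series (fun n => `|b n| * `|k n|%:~R ^+ r')) ->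
    continuous (trig_observable R d l b k psi).
  move=> cb; apply: continuous_row => i; rewrite coord.
  apply: trig_series_continuous.
  apply: series_le_cvg cb => n; first exact: normr_ge0.
    by apply: mulr_ge0; rewrite ?exprn_ge0 ?ler0z.
  by rewrite ler_peMr// exprn_ege1// normr_int_ge1.
elim: r a phi => [|r IH] a phi cr; split => //; try exact: (cont _ _ _ cr).
move=> j.
have c1 : cvgn (series (fun n => `|a n| * `|k n|%:~R)).
  apply: series_le_cvg cr => n; try by apply: mulr_ge0; rewrite ?exprn_ge0 ?ler0z.
  by rewrite ler_wpM2l// exprS ler_peMr ?ler0z// exprn_ege1// normr_int_ge1.
have dv x : derivable (trig_observable R d l a k phi) x 'e_j.
  apply/derivable_mxP => i0 i; rewrite (ord1 i0) coord.
  by apply/cvg_ex; eexists; exact: trig_series_derive.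
split=> //.
rewrite (_ : (fun x => _) = trig_observable R d l
    (fun n => 2 * pi * (k n 0 j)%:~R * a n) k (fun n i => phi n i + pi / 2)).
  have cr2 := @is_cvg_seriesZ _ _ (2 * pi) cr.
  apply: IH; apply: series_le_cvg cr2 => n.
  - by apply: mulr_ge0; rewrite ?exprn_ge0 ?ler0z.
  - by rewrite !mulr_ge0 ?exprn_ge0 ?ler0z// pi_ge0.
  apply: le_trans (_ : 2 * pi * (`|a n| * `|k n|%:~R ^+ r.+1) <= _); last by [].
  rewrite !normrM (ger0_norm (pi_ge0 R)) (ger0_norm (ler0n _ 2)) exprS.
  set c := 2 * pi * `|a n| * `|k n|%:~R ^+ r.
  rewrite (_ : _ * _ * _ * _ = c * `|(k n 0 j)%:~R|); last by rewrite /c; ring.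
  rewrite (_ : _ * _ * _ = c * `|k n|%:~R); last by rewrite /c; ring.
  rewrite ler_wpM2l//; first by rewrite /c !mulr_ge0 ?pi_ge0 ?exprn_ge0 ?ler0z.
  by rewrite -intr_norm ler_int; exact: normr_coord_le.
apply/funext => x; apply/rowP => i; rewrite derive_mx// !mxE coord.
by apply: cvg_lim => //; exact: trig_series_derive.
Qed.

End Smoothness.

Section Observable.
Variables (R : realType) (d l : nat) (Delta : R -> R) (k : nat -> 'rV[int]_d).
Hypothesis aD : approximation_function Delta.
Hypothesis gs : gauge_summable Delta d 0.
Hypothesis k0 : forall n, k n != 0.
Hypothesis kincr : forall m n, (m < n)%N -> `|k m| < `|k n|.

Lemma approximation_function_gt0 x : 1 <= x -> 0 < Delta x.
Proof.
case: aD => _ D1 D0 _; rewrite le_eqVlt => /predU1P[<-//|x1].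
by apply: lt_trans D0 _; apply: D1 => //; rewrite in_itv/= ?lexx// ltW.
Qed.

Lemma gauge_gt0 (k' : 'rV[int]_d) : k' != 0 -> 0 < gauge Delta k'.
Proof.
by move=> k'0; rewrite invr_gt0 approximation_function_gt0// normr_int_ge1.
Qed.

(** By injectivity of [k] this is a subseries of the sum over all nonzero frequencies. *)
Lemma gauge_summable_freq r : gauge_summable Delta d r ->
  cvgn (series (fun n => gauge Delta (k n) * `|k n|%:~R ^+ r)).
Proof.
rewrite /gauge_summable => sr.
pose g (k' : 'rV[int]_d) := (`|k'|%:~R ^+ r * gauge Delta k')%:E.
have g0 n : (0 <= g (k n))%E.
  by rewrite lee_fin mulr_ge0 ?exprn_ge0 ?ler0z// ltW// gauge_gt0.
apply: nnseries_is_cvg => [n|].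
  by rewrite mulrC -lee_fin g0.
apply: le_lt_trans sr.
have inj : set_inj [set: nat] k by move=> m n _ _; exact: (freq_inj d k kincr).
rewrite (eq_eseriesr (g := g \o k)); last by move=> n _; rewrite /= mulrC.
rewrite nneseries_esumT// -(esum_image setT k g)//.
apply: ge_ereal_sup => _ [X [finX XS] <-].
apply: ereal_sup_ubound; exists X => //; split=> // _ /XS[n _ <-].
exact: k0.
Qed.

Lemma trig_observable_observable (phi : nat -> 'I_l -> R) :
  observable Delta
    (trig_observable R d l (fun n => 2 * gauge Delta (k n)) k phi).
Proof.
have ck r : gauge_summable Delta d r ->
    cvgn (series (fun n => `|2 * gauge Delta (k n)| * `|k n|%:~R ^+ r)).
  move=> /gauge_summable_freq cr; have := @is_cvg_seriesZ _ _ 2 cr.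
  rewrite (_ : 2 *: _ = fun n => `|2 * gauge Delta (k n)| * `|k n|%:~R ^+ r)//.
  apply/funext => n; rewrite ger0_norm ?mulr_ge0 ?(ltW (gauge_gt0 _ _))//.
  exact: mulrA.
have ca : cvgn (series (fun n => `|2 * gauge Delta (k n)|)).
  by move: (ck _ gs); under eq_fun do rewrite expr0 mulr1.
split=> //.
- move=> x k'; apply/rowP => i; rewrite !mxE; exact: trig_series_periodic.
- by move=> r /ck cr; exact: trig_observable_of_class.
- exact: trig_observable_fourier_series.
- move=> k' k'0; apply: fourier_norm_le => //; first exact/ltW/gauge_gt0.
  move=> n e; rewrite ger0_norm; last by rewrite mulr_ge0// ltW// gauge_gt0.
  by rewrite mulrC mulKf// /gauge e.
Qed.

End Observable.

(** * Weighted averages of a single mode *)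

Section Weight.
Variables (R : realType) (beta : R) (w : R -> R).
Hypothesis wc : weight_class beta w.
Local Notation D m := (derive1n m w).

Lemma weight_ge0 x : 0 <= w x.
Proof. by case: wc => -[]. Qed.

Lemma is_derive_weight m (x : R) : is_derive x 1 (D m) (D m.+1 x).
Proof.
case: wc => -[_ dw _ _] _ _; rewrite /= derive1E.
exact: derivableP.
Qed.

Lemma continuous_weight m : continuous (D m).
Proof.
move=> x; apply/differentiable_continuous/derivable1_diffP.
exact: (@ex_derive _ _ _ _ _ _ _ (is_derive_weight m x)).
Qed.

Lemma is_derive_rescaled_weight N m (s : R) :
  is_derive s 1 (fun s : R => derive1n m w (s / N%:R))
    (N%:R^-1 * derive1n m.+1 w (s / N%:R)).
Proof.
have d1 : is_derive s 1 (fun t : R => t / N%:R) N%:R^-1.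
  by apply: is_derive_eq; rewrite scaler0 add0r /GRing.scale/= mulr1.
have := @is_derive1_comp R _ (fun t : R => t / N%:R) s _ _ (is_derive_weight m (s / N%:R)) d1.
by rewrite mulrC.
Qed.

(** The endpoints are a hypothesis; outside [[0, 1]], an open set, each derivative is that of a
    locally zero function. *)
Lemma weight_out m x : x \notin `]0, 1[ -> D m x = 0.
Proof.
case: wc => -[_ _ w0 _] wb _; have [->|x0] := eqVneq x 0.
  by rewrite (wb m).1.
have [->|x1] := eqVneq x 1; first by rewrite (wb m).2.
rewrite in_itv/= => xn; have {x0 x1 xn} : x \in ~` `[0, 1]%classic.
  rewrite inE /= in_itv/=; apply/negP; apply: contra xn => /andP[? ?].
  by rewrite !lt_neqAle eq_sym x0 x1; apply/andP.
have oI : open (~` `[0, 1]%classic : set R) by apply: closed_openC; exact: itv_closed.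
elim: m x => [|m IH] x; rewrite inE => xI.
  by apply: w0; apply/negP.
rewrite /= derive1E -[RHS](derive_cst (0 : R) x (1 : R)).
apply: near_eq_derive.
by near=> y; apply: IH; rewrite inE; near: y; exact: oI.
Unshelve. all: by end_near. Qed.

(** The derivative of order [m] vanishes at 0, so it is the integral of the next one. The given
    bounds in the mean thus become uniform at the cost of one order, whence [m.+1]. *)
Lemma weight_bound : exists C lambda : R, [/\ 0 < C, 0 < lambda &
  forall m x, `|D m x| <=
    C * lambda ^+ m.+1 * (m.+1%:R `^ (m.+1%:R * beta))].
Proof.
case: wc => _ _ [C [lam [C0 lam0 h]]]; exists C, lam; split=> // m x.
have [|xn] := boolP (x \in `]0, 1[); last first.
  by rewrite weight_out// normr0 !mulr_ge0 ?exprn_ge0 ?powR_ge0 ?ltW.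
rewrite in_itv/= => /andP[x0 x1].
have dx := Rintegral_FTC _ _ _ _ _ (ltW x0) (is_derive_weight m) (continuous_weight m.+1).
rewrite (weight_out m 0) ?in_itv/= ?ltxx// subr0 in dx.
rewrite -dx -lee_fin; apply: le_trans (h m.+1 (ltn0Sn m)).
have cI := continuous_integrable _ _ 0 x (continuous_weight m.+1).
rewrite EFin_normr_Rintegral//.
have mf := measurable_int _ (continuous_integrable _ _ 0 1 (continuous_weight m.+1)).
have sub : `]0, x[ `<=` (`[0, 1] : set R).
  move=> y /=; rewrite !in_itv/= => /andP[y0 yx].
  by rewrite (ltW y0) ltW// (lt_trans yx).
rewrite integral_itv_bndoo; last exact: (measurable_funS _ sub mf).
apply: le_trans (le_abse_integral _ _ _) _ => //; first exact: (measurable_funS _ sub mf).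
apply: ge0_subset_integral => //.
- have ca : continuous (fun y => `|D m.+1 y|).
    by move=> y; apply: cvg_norm; exact: continuous_weight.
  apply: measurable_funS (measurable_int _ (continuous_integrable _ _ 0 1 ca)) => //.
  exact: subset_itv_oo_cc.
- by move=> y /=; rewrite !in_itv/= => /andP[-> /lt_trans]; apply.
Qed.

End Weight.

(** * Summation by parts *)

Section BackwardDifference.
Variable R : realType.
Implicit Types g : R -> R.

Definition bdiff g (x : R) : R := g x - g (x - 1).

(* The resonance factor: summation by parts trades [2 sin (pi omega)] for a
   difference, since [cos (t - pi omega) - cos (t + pi omega)] is
   [2 sin (pi omega) sin t]. *)
Lemma sum_by_parts g (omega psi : R) (L : nat) :
  g (- 1) = 0 -> g L%:R = 0 ->
  2 * sin (pi * omega) * (\sum_(0 <= n < L.+1) g n%:R * cos (2 * pi * omega * n%:R + psi))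
  = \sum_(0 <= n < L.+1) bdiff g n%:R *
      cos (2 * pi * omega * n%:R + (psi - pi * omega + pi / 2)).
Proof.
move=> g1 gL; set psi' := psi - _ + _.
pose c (n : nat) := cos (2 * pi * omega * n%:R + psi').
have -> : \sum_(0 <= n < L.+1) bdiff g n%:R * cos (2 * pi * omega * n%:R + psi') =
    \sum_(0 <= n < L.+1) g n%:R * c n - \sum_(0 <= n < L.+1) g n%:R * c n.+1.
  rewrite /bdiff; under eq_bigr do rewrite mulrBl; rewrite sumrB; congr (_ - _).
  rewrite big_nat_recl//= sub0r g1 mul0r add0r.
  rewrite [RHS]big_nat_recr//= gL mul0r addr0.
  by apply: eq_bigr => n _; rewrite /c -[n.+1]addn1 natrD addrK.
rewrite -sumrB mulr_sumr; apply: eq_bigr => n _.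
rewrite -mulrBr mulrCA; congr (_ * _).
set t := 2 * pi * omega * n%:R + psi.
rewrite /c (_ : _ + psi' = (t - pi * omega) + pi / 2); last by rewrite /t /psi'; ring.
rewrite (_ : 2 * pi * omega * n.+1%:R + psi' = (t + pi * omega) + pi / 2); last first.
  by rewrite /t /psi' -[n.+1]addn1 natrD; ring.
by rewrite !cosDpihalf (sinB t) (sinD t); ring.
Qed.

(** Backward differences spread the support to the right only, by 1 each time. *)
Lemma iter_bdiff_out g (j : nat) (N : R) :
  (forall x, x <= 0 -> g x = 0) -> (forall x, N <= x -> g x = 0) ->
  (forall x, x <= 0 -> iter j bdiff g x = 0) /\
  (forall x, N + j%:R <= x -> iter j bdiff g x = 0).
Proof.
move=> g0 gN; elim: j => [|j [IH0 IHN]] /=; first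
  by split=> [//|x]; rewrite addr0; exact: gN.
by split=> x xj; rewrite /bdiff; [rewrite !IH0|rewrite !IHN]; rewrite ?subrr//;
  move: xj; rewrite -?[j.+1]addn1 ?natrD; lra.
Qed.

(** The range [(N + m).+1] is fixed beforehand, wide enough for the supports of all differences up
    to order [m]. The phase stays existential because only the bound 1 on the cosine is used
    afterwards. *)
Lemma iter_sum_by_parts g (omega psi : R) (N j m : nat) : (j <= m)%N ->
  (forall x, x <= 0 -> g x = 0) -> (forall x, N%:R <= x -> g x = 0) ->
  exists psi', (2 * sin (pi * omega)) ^+ j *
    (\sum_(0 <= n < (N + m).+1) g n%:R * cos (2 * pi * omega * n%:R + psi)) =
   \sum_(0 <= n < (N + m).+1) iter j bdiff g n%:R *
      cos (2 * pi * omega * n%:R + psi').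
Proof.
move=> jm g0 gN; elim: j jm => [|j IH] jm; first by exists psi; rewrite expr0 mul1r.
have [psi' h] := IH (ltnW jm).
have [h0 hN] := iter_bdiff_out g j N%:R g0 gN.
eexists; rewrite exprS -mulrA h sum_by_parts//; first by apply: h0; lra.
by apply: hN; rewrite -natrD ler_nat leq_add2l ltnW.
Qed.

Lemma is_derive_iter_bdiff (j : nat) (G G' : R -> R) :
  (forall x : R, is_derive x 1 G (G' x)) ->
  forall x : R, is_derive x 1 (iter j bdiff G) (iter j bdiff G' x).
Proof.
move=> dG; elim: j => [//|j IH] x /=.
rewrite /bdiff.
have d : is_derive x 1 (fun t : R => iter j bdiff G (t - 1)) (iter j bdiff G' (x - 1)).
  have d1 : is_derive x 1 (fun t : R => t - 1) 1 by apply: is_derive_eq; rewrite subr0.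
  have := @is_derive1_comp R _ (fun t : R => t - 1) x _ _ (IH (x - 1)) d1.
  by rewrite mulr1.
exact: is_deriveB.
Qed.

End BackwardDifference.

Section WeightDifference.
Variables (R : realType) (beta : R) (w : R -> R).
Hypothesis wc : weight_class beta w.

(* [bdiff] commutes with differentiation, so each of the [j] differences costs
   one derivative of [w (x / N)], that is, a factor [1 / N]. *)
Lemma iter_bdiff_weight_le (N : nat) (M : nat -> R) (j m : nat) (x : R) :
  (0 < N)%N -> (forall m x, `|derive1n m w x| <= M m) ->
  `|iter j (@bdiff R) (fun x => derive1n m w (x / N%:R)) x| <= N%:R ^- j * M (m + j)%N.
Proof.
move=> N0 wM; elim: j m x => [|j IH] m x.
  by rewrite expr0 invr1 mul1r addn0 /=.
have dG := is_derive_rescaled_weight _ _ _ wc N.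
have scale (c : R) (g : R -> R) i y :
    iter i (@bdiff R) (fun x => c * g x) y = c * iter i (@bdiff R) g y.
  by elim: i y => [//|i IHi] y /=; rewrite /bdiff !IHi mulrBr.
have dH m' := is_derive_iter_bdiff R j _ _ (dG m').
have cH : continuous (iter j (@bdiff R) (fun x => N%:R^-1 * derive1n m.+1 w (x / N%:R))).
  rewrite (_ : iter _ _ _ = fun y => N%:R^-1 *
      iter j (@bdiff R) (fun x => derive1n m.+1 w (x / N%:R)) y); last first.
    by apply/funext => y; rewrite scale.
  move=> y; apply: cvgM; first exact: cvg_cst.
  apply/differentiable_continuous/derivable1_diffP.
  exact: (@ex_derive _ _ _ _ _ _ _ (dH m.+1 y)).
have hb y : `|iter j (@bdiff R) (fun x => N%:R^-1 * derive1n m.+1 w (x / N%:R)) y| <=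
    N%:R ^- j.+1 * M (m + j.+1)%N.
  rewrite scale normrM ger0_norm ?invr_ge0// exprS invfM -mulrA addnS -addSn.
  by rewrite ler_wpM2l ?invr_ge0.
have := lipschitz_of_derive R _ _ _ x (x - 1) (dH m) cH hb.
by rewrite subKr normr1 mulr1.
Qed.

(** A single sample near a point where [w] is positive suffices. The factor [N] lost against the
    true size is harmless beside a superpolynomial decay. *)
Lemma weight_sum_ge : exists2 c : R, 0 < c &
  exists N0, forall N, (N0 <= N)%N -> c <= weight_sum w N.
Proof.
have [x0 wx0] : exists x0, 0 < w x0.
  apply/not_existsP => w0; case: wc => -[_ _ _ int1] _ _; move: int1.
  rewrite (eq_integral (cst 0%E)); last first.
    move=> x _; have := w0 x; rewrite lt_neqAle (weight_ge0 _ _ _ wc) andbT.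
    by move=> /negP/negPn/eqP <-.
  by rewrite integral0 => /eqP; rewrite eqe eq_sym oner_eq0.
have x01 : x0 \in `]0, 1[.
  apply/negPn/negP => /(weight_out _ _ _ wc 0) /= wx; move: wx0.
  by rewrite wx ltxx.
move: x01; rewrite in_itv/= => /andP[x00 x01].
have c0 : 0 < w x0 / 2 by rewrite divr_gt0.
exists (w x0 / 2) => //.
have cw := continuous_weight _ _ _ wc 0%N x0.
have [d /= d0 dw] := (cvgrPdist_lt _ _).1 cw _ c0.
have id0 : 0 < d^-1 by rewrite invr_gt0.
exists (Num.trunc d^-1).+1 => N hN.
have N0 : (0 < N)%N by apply: leq_trans hN.
have Nr0 : 0 < N%:R :> R by rewrite ltr0n.
have dN : d^-1 < N%:R.
  have /andP[_ h] := truncn_itv (ltW id0).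
  by apply: lt_le_trans h _; rewrite ler_nat.
(* The sample [n / N] lies within [1 / N < d] of [x0]. *)
pose n := Num.trunc (N%:R * x0).
have /andP[n1 n2] := truncn_itv (mulr_ge0 (ltW Nr0) (ltW x00)).
have nN : (n < N)%N.
  by rewrite -(ltr_nat R) (le_lt_trans n1)// gtr_pMr.
have wn : w x0 / 2 <= w (n%:R / N%:R).
  have : ball x0 d (n%:R / N%:R).
    rewrite /ball/= ger0_norm; last by rewrite subr_ge0 ler_pdivrMr// mulrC.
    apply: (@lt_trans _ _ N%:R^-1); last first.
      by rewrite -[ltRHS]invrK ltf_pV2// posrE// invr_gt0.
    rewrite ltrBlDl -[X in _ + X]mul1r -mulrDl ltr_pdivlMr// mulrC.
    by rewrite natr1.
  move=> /dw /=; rewrite ltr_norml => /andP[_]; rewrite /= => h; lra.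
apply: le_trans wn _; rewrite /weight_sum big_mkord (bigD1 (Ordinal nN))//=.
by rewrite lerDl sumr_ge0// => i _; exact: (weight_ge0 _ _ _ wc).
Qed.

End WeightDifference.

(** * Averages of one cosine: resonance and decay *)

Section Averages.
Variables (R : realType) (beta : R) (w : R -> R).
Hypothesis wc : weight_class beta w.

Definition dis_avg (N : nat) (omega psi : R) : R :=
  (weight_sum w N)^-1 *
  \sum_(0 <= n < N) w (n%:R / N%:R) * cos (2 * pi * omega * n%:R + psi).

(** Integer times suffice, as a mode is tested at the time given by its norm. *)
Definition con_avg (N : nat) (omega psi : R) : R :=
  N%:R^-1 * \int[lebesgue_measure]_(s in `[0, N%:R])
    (w (s / N%:R) * cos (2 * pi * omega * s + psi)).

Let w0 := weight_ge0 R beta w wc.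

Lemma weight_sum_ge0 N : 0 <= weight_sum w N.
Proof. by rewrite /weight_sum sumr_ge0. Qed.

Lemma dis_avg_le1 N omega psi : `|dis_avg N omega psi| <= 1.
Proof.
rewrite /dis_avg; have [->|A0] := eqVneq (weight_sum w N) 0.
  by rewrite invr0 mul0r normr0.
have Ap : 0 < weight_sum w N by rewrite lt_neqAle eq_sym A0 weight_sum_ge0.
rewrite normrM normfV (gtr0_norm Ap) ler_pdivrMl// mulr1.
apply: le_trans (ler_norm_sum _ _ _) _; apply: ler_sum => n _.
by apply: le_trans (normr_mul_cos_le _ _ _) _; rewrite ger0_norm.
Qed.

(** At integer times [omega] may be replaced by [omega - p]; the phase then moves by at most
    [2 * pi * N * |omega - p|] during the whole average. *)
Lemma dis_avg_resonant N omega psi (p : int) : 0 < weight_sum w N ->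
  `|dis_avg N omega psi - cos psi| <= 2 * pi * (N%:R * `|omega - p%:~R|).
Proof.
move=> Ap; have A0 := gt_eqF Ap.
have -> : dis_avg N omega psi - cos psi = (weight_sum w N)^-1 *
    \sum_(0 <= n < N) w (n%:R / N%:R) *
      (cos (2 * pi * (omega - p%:~R) * n%:R + psi) - cos psi).
  rewrite /dis_avg; under [in RHS]eq_bigr do rewrite mulrBr.
  rewrite sumrB -mulr_suml mulrBr -/(weight_sum w N) mulKf ?A0//.
  congr (_ * _ - _); apply: eq_bigr => n _; congr (_ * _).
  rewrite -(cosDz _ _ (- p * n)); congr cos.
  by rewrite intrM mulrNz -pmulrn; ring.
rewrite normrM normfV (gtr0_norm Ap) ler_pdivrMl//.
apply: le_trans (ler_norm_sum _ _ _) _.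
rewrite /weight_sum mulr_suml; apply: ler_sum_nat => n /andP[_ nN].
rewrite normrM (ger0_norm (w0 _)) ler_wpM2l//.
apply: le_trans (cos_lipschitz _ _ _) _; rewrite addrK !normrM.
rewrite (ger0_norm (pi_ge0 R)) (ger0_norm (ler0n _ 2)) -!mulrA.
rewrite ler_wpM2l// ler_wpM2l ?pi_ge0//.
by rewrite mulrC ler_wpM2r// ger0_norm// ler_nat ltnW.
Qed.

(** The constants do not depend on [m], the number of summations or integrations by parts, so [m]
    may later be chosen as a function of [N]. The factor in front pays for the number of terms and
    for the crude bound on [weight_sum]. *)
Definition superpoly_bound (V : nat -> R -> R -> R) (omega : R) :=
  exists K kappa : R, [/\ 0 < K, 0 < kappa & exists N0, forall N m psi,
    (N0 <= N)%N ->
    `|V N omega psi| <= K * N%:R ^+ 2 * m.+1%:R *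
      (kappa * m.+1%:R `^ beta / N%:R) ^+ m.+1].

Lemma powR_mulrn_mul (m : nat) :
  m.+1%:R `^ (m.+1%:R * beta) = (m.+1%:R `^ beta) ^+ m.+1 :> R.
Proof. by rewrite mulrC powRrM powR_mulrn// powR_ge0. Qed.

Lemma dis_avg_decay omega : sin (pi * omega) != 0 -> superpoly_bound dis_avg omega.
Proof.
move=> s0; have [C [lam [C0 lam0 wM]]] := weight_bound _ _ _ wc.
have [c c0 [N1 hc]] := weight_sum_ge _ _ _ wc.
pose M (m : nat) := C * lam ^+ m.+1 * m.+1%:R `^ (m.+1%:R * beta).
have {}wM : forall m x, `|derive1n m w x| <= M m := wM.
pose s := `|2 * sin (pi * omega)|.
have sp : 0 < s by rewrite normr_gt0 mulf_neq0.
exists (2 * c^-1 * C * s), (lam / s); split.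
- by rewrite !mulr_gt0 ?invr_gt0.
- by rewrite divr_gt0.
exists N1.+1 => N m psi N1N.
have N0 : (0 < N)%N by apply: leq_trans N1N.
have Np : 0 < N%:R :> R by rewrite ltr0n.
pose g (x : R) := w (x / N%:R).
have g0 x : x <= 0 -> g x = 0.
  move=> x0; apply: (weight_out _ _ _ wc 0); rewrite in_itv/= negb_and -leNgt.
  by rewrite pmulr_lle0 ?invr_gt0// x0.
have gN x : N%:R <= x -> g x = 0.
  move=> xN; apply: (weight_out _ _ _ wc 0); rewrite in_itv/= negb_and -!leNgt.
  by rewrite ler_pdivlMr// mul1r xN orbT.
have [psi' h] := iter_sum_by_parts R g omega psi N m m (leqnn m) g0 gN.
set S := \sum_(0 <= n < _) _ in h.
have SE : S = \sum_(0 <= n < N) w (n%:R / N%:R) * cos (2 * pi * omega * n%:R + psi).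
  rewrite /S (big_cat_nat (n := N))//=; last by rewrite -addnS leq_addr.
  rewrite -[RHS]addr0; congr (_ + _).
  rewrite big_nat_cond big1// => n /andP[/andP[Nn _] _].
  by rewrite gN ?mul0r// ler_nat.
have hS : s ^+ m * `|S| <= (N + m).+1%:R * (N%:R ^- m * M m).
  rewrite /s -normrX -normrM h.
  apply: le_trans (ler_norm_sum _ _ _) _.
  apply: le_trans (_ : \sum_(0 <= n < (N + m).+1) N%:R ^- m * M m <= _); last first.
    by rewrite sumr_const_nat subn0 mulr_natl.
  apply: ler_sum => n _; apply: le_trans (normr_mul_cos_le _ _ _) _.
  have := iter_bdiff_weight_le _ _ _ wc N M m 0 n%:R N0 wM.
  by rewrite add0n.
have Ac := hc _ (ltnW N1N).
have Ap := lt_le_trans c0 Ac.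
rewrite /dis_avg -SE normrM normfV (gtr0_norm Ap).
apply: le_trans (_ : c^-1 * `|S| <= _).
  by rewrite ler_wpM2r// lef_pV2.
have smp : 0 < s ^+ m by rewrite exprn_gt0.
rewrite -(ler_pM2l smp) mulrCA.
apply: le_trans (ler_wpM2l _ hS) _; first by rewrite invr_ge0 ltW.
rewrite /M powR_mulrn_mul.
set y := m.+1%:R `^ beta.
have y0 : 0 <= y by exact: powR_ge0.
rewrite (_ : s ^+ m * _ = c^-1 * ((N%:R * (2 * m.+1%:R)) *
    (N%:R ^- m * (C * lam ^+ m.+1 * y ^+ m.+1)))); last first.
  rewrite !exprMn !exprVn [s ^+ m.+1]exprS [N%:R ^+ m.+1]exprS.
  by field; rewrite !expf_neq0 ?gt_eqF.
rewrite ler_wpM2l ?invr_ge0 ?(ltW c0)// ler_wpM2r//.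
  by rewrite !mulr_ge0 ?invr_ge0 ?exprn_ge0// ltW.
(* [N + m.+1 <= 2 * N * m.+1], both summands being at most the product of [N] and [m.+1]. *)
by rewrite -!natrM ler_nat mulnCA mul2n -addnn -addnS leq_add// ?leq_pmulr ?leq_pmull.
Qed.

Lemma continuous_rescaled_weight N m :
  continuous (fun s : R => derive1n m w (s / N%:R) : R).
Proof.
move=> s; apply/differentiable_continuous/derivable1_diffP.
exact: (@ex_derive _ _ _ _ _ _ _ (is_derive_rescaled_weight _ _ _ wc N m s)).
Qed.

Lemma continuous_con_integrand N m (a b : R) :
  continuous (fun s : R => derive1n m w (s / N%:R) * cos (a * s + b)).
Proof.
move=> s; apply: cvgM; first exact: continuous_rescaled_weight.
exact: continuous_affine_cos.
Qed.

Lemma integral_rescaled_weight N : (0 < N)%N ->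
  \int[lebesgue_measure]_(s in `[0, N%:R]) w (s / N%:R) = N%:R.
Proof.
move=> N0; have Np : 0 < N%:R :> R by rewrite ltr0n.
pose F (s : R) := s / N%:R.
have dF (s : R) : is_derive s 1 F N%:R^-1.
  by apply: is_derive_eq; rewrite scaler0 add0r /GRing.scale/= mulr1.
have dFE : derive1 F = cst N%:R^-1.
  by apply/funext => s; rewrite derive1E; exact: (@derive_val _ _ _ _ _ _ _ (dF s)).
have cF : continuous F.
  move=> s; apply/differentiable_continuous/derivable1_diffP.
  exact: (@ex_derive _ _ _ _ _ _ _ (dF s)).
have cw := continuous_rescaled_weight N 0.
have := @integration_by_substitution_increasing R F w 0 N%:R (ltW Np).
rewrite /F mul0r divff ?gt_eqF// -/F.
case: wc => -[_ _ _ ->] _ _ h.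
have {}h := h _ _ _ _ _ _.
have : \int[lebesgue_measure]_(x in `[0, N%:R]) (w (x / N%:R) * N%:R^-1) = 1.
  transitivity (fine (1%E : \bar R)); last by [].
  rewrite /Rintegral h ?dFE//.
  - by move=> x y _ _ xy; rewrite /F ltr_pM2r ?invr_gt0.
  - by move=> x _; exact: cst_continuous.
  - exact: is_cvg_cst.
  - exact: is_cvg_cst.
  - split.
    + by move=> x _; exact: (@ex_derive _ _ _ _ _ _ _ (dF x)).
    + by apply: cvg_at_right_filter; exact: cF.
    + by apply: cvg_at_left_filter; exact: cF.
  - by apply: continuous_subspaceT; exact: (continuous_weight _ _ _ wc 0).
rewrite RintegralZr//; last exact: continuous_integrable.
by move/(congr1 (fun x => x * N%:R)); rewrite mulfVK ?gt_eqF// mul1r.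
Qed.

Lemma con_avg_weighted_le N (h : R -> R) (M : R) : (0 < N)%N -> continuous h ->
  (forall s, 0 <= s <= N%:R -> `|h s| <= M) ->
  `|N%:R^-1 * \int[lebesgue_measure]_(s in `[0, N%:R]) (w (s / N%:R) * h s)| <= M.
Proof.
move=> N0 ch hM; have Np : 0 < N%:R :> R by rewrite ltr0n.
rewrite normrM normfV (gtr0_norm Np) ler_pdivrMl//.
have cw := continuous_rescaled_weight N 0.
have cwh : continuous (fun s : R => w (s / N%:R) * h s).
  by move=> s; apply: continuousM; [exact: cw|exact: ch].
apply: (le_trans (le_normr_Rintegral _ _)) => //; first exact: continuous_integrable.
have -> : N%:R * M = \int[lebesgue_measure]_(s in `[0, N%:R]) (w (s / N%:R) * M).
  by rewrite RintegralZr ?integral_rescaled_weight//; exact: continuous_integrable.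
apply: le_Rintegral => //.
- apply: (continuous_integrable R (fun x => `|w (x / N%:R) * h x|)) => x.
  by apply: cvg_norm; exact: cwh.
- apply: (continuous_integrable R (fun x => w (x / N%:R) * M)) => x.
  by apply: continuousM; [exact: cw|exact: cst_continuous].
- move=> s /=; rewrite in_itv => sN.
  by rewrite normrM (ger0_norm (w0 _)) ler_wpM2l// hM.
Qed.

Lemma con_avg_le1 N omega psi : `|con_avg N omega psi| <= 1.
Proof.
have [->|N0] := posnP N; first by rewrite /con_avg invr0 mul0r normr0.
apply: con_avg_weighted_le => //; first exact: continuous_affine_cos.
by move=> s _; rewrite cos_max.
Qed.

Lemma con_avg_resonant N omega psi : (0 < N)%N ->
  `|con_avg N omega psi - cos psi| <= 2 * pi * (N%:R * `|omega|).
Proof.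
move=> N0; have Np : 0 < N%:R :> R by rewrite ltr0n.
have cc := continuous_affine_cos R (2 * pi * omega) psi.
have cw := continuous_rescaled_weight N 0.
have -> : con_avg N omega psi - cos psi = N%:R^-1 *
    \int[lebesgue_measure]_(s in `[0, N%:R])
      (w (s / N%:R) * (cos (2 * pi * omega * s + psi) - cos psi)).
  under [in RHS]eq_Rintegral do rewrite mulrBr.
  rewrite RintegralB//; first last.
  - apply: continuous_integrable => s; apply: continuousM; first exact: cw.
    exact: cst_continuous.
  - exact: (continuous_integrable _ _ _ _ (continuous_con_integrand N 0 _ _)).
  rewrite RintegralZr//; last exact: continuous_integrable.
  by rewrite integral_rescaled_weight// mulrBr mulKf// gt_eqF.
apply: con_avg_weighted_le => //.
  by move=> s; apply: cvgB; [exact: cc|exact: cvg_cst].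
move=> s /andP[s0 sN]; apply: le_trans (cos_lipschitz _ _ _) _; rewrite addrK !normrM.
rewrite (ger0_norm (pi_ge0 R)) (ger0_norm (ler0n _ 2)) -!mulrA.
rewrite ler_wpM2l// ler_wpM2l ?pi_ge0//.
by rewrite mulrC ler_wpM2r// ger0_norm.
Qed.

(** Integrate the derivative of the weight times a sine: the boundary terms vanish with the
    derivatives of [w] at 0 and 1, and minus the sine is a cosine of shifted phase. *)
Lemma con_avg_by_parts N m (omega psi : R) : (0 < N)%N ->
  2 * pi * omega * N%:R *
    \int[lebesgue_measure]_(s in `[0, N%:R])
      (derive1n m w (s / N%:R) * cos (2 * pi * omega * s + psi)) =
  \int[lebesgue_measure]_(s in `[0, N%:R])
    (derive1n m.+1 w (s / N%:R) * cos (2 * pi * omega * s + (psi + pi / 2))).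
Proof.
move=> N0; have Np : 0 < N%:R :> R by rewrite ltr0n.
set a := 2 * pi * omega.
pose G (s : R) := derive1n m w (s / N%:R) * sin (a * s + psi).
pose g1 (s : R) := a * (derive1n m w (s / N%:R) * cos (a * s + psi)).
pose g2 (s : R) := N%:R^-1 * (derive1n m.+1 w (s / N%:R) * sin (a * s + psi)).
have dG (s : R) : is_derive s 1 G (g1 s + g2 s).
  have d1 := is_derive_rescaled_weight _ _ _ wc N m s.
  have d2 := is_derive_affine_sin R a psi s.
  apply: is_derive_eq; rewrite /g1 /g2 /GRing.scale/=; ring.
have cs (b : R) : continuous (fun s : R => sin (a * s + b)).
  move=> s; apply/differentiable_continuous/derivable1_diffP.
  exact: (@ex_derive _ _ _ _ _ _ _ (is_derive_affine_sin R a b s)).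
have c1 : continuous g1.
  by move=> s; apply: cvgM; [exact: cvg_cst|exact: continuous_con_integrand].
have c2' : continuous (fun s : R => derive1n m.+1 w (s / N%:R) * sin (a * s + psi)).
  by move=> s; apply: cvgM; [exact: continuous_rescaled_weight|exact: cs].
have c2 : continuous g2.
  by move=> s; apply: cvgM; [exact: cvg_cst|exact: c2'].
have c12 : continuous (fun s => g1 s + g2 s).
  by move=> s; apply: continuousD; [exact: c1|exact: c2].
have := Rintegral_FTC R _ _ _ _ (ltW Np) dG c12.
rewrite /G divff ?gt_eqF// mul0r !(weight_out _ _ _ wc) ?in_itv/= ?ltxx ?andbF//.
rewrite !mul0r subr0 RintegralD//; try exact: continuous_integrable.
rewrite RintegralZl//; last first.
  exact: (continuous_integrable _ _ _ _ (continuous_con_integrand N m _ _)).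
rewrite RintegralZl//; last exact: continuous_integrable.
move=> /eqP; rewrite addr_eq0 => /eqP e.
rewrite mulrAC e mulNr mulrAC mulVf ?gt_eqF// mul1r.
transitivity (\int[lebesgue_measure]_(s in `[0, N%:R])
    (-1 * (derive1n m.+1 w (s / N%:R) * sin (a * s + psi)))).
  by rewrite RintegralZl ?mulN1r//; exact: continuous_integrable.
by apply: eq_Rintegral => s _; rewrite addrA cosDpihalf mulN1r mulrN.
Qed.

Lemma con_avg_decay omega : omega != 0 -> superpoly_bound con_avg omega.
Proof.
move=> om0; have [C [lam [C0 lam0 wM]]] := weight_bound _ _ _ wc.
pose M (m : nat) := C * lam ^+ m.+1 * m.+1%:R `^ (m.+1%:R * beta).
have {}wM : forall m x, `|derive1n m w x| <= M m := wM.
pose s := `|2 * pi * omega|.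
have sp : 0 < s by rewrite normr_gt0 !mulf_neq0// gt_eqF// pi_gt0.
exists (C * s), (lam / s); split; [exact: mulr_gt0|exact: divr_gt0|].
exists 1%N => N m psi N0.
have Np : 0 < N%:R :> R by rewrite ltr0n.
have parts j phi : exists phi', (2 * pi * omega * N%:R) ^+ j *
    \int[lebesgue_measure]_(s in `[0, N%:R])
      (w (s / N%:R) * cos (2 * pi * omega * s + phi)) =
    \int[lebesgue_measure]_(s in `[0, N%:R])
      (derive1n j w (s / N%:R) * cos (2 * pi * omega * s + phi')).
  elim: j => [|j [phi' IH]]; first by exists phi; rewrite expr0 mul1r.
  by eexists; rewrite exprS -mulrA IH con_avg_by_parts.
have [psi' h] := parts m psi.
have hS : (s * N%:R) ^+ m * `|\int[lebesgue_measure]_(s in `[0, N%:R])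
      (w (s / N%:R) * cos (2 * pi * omega * s + psi))| <= M m * N%:R.
  rewrite -{1}(ger0_norm (ltW Np)) /s -normrM -normrX -normrM h -[X in _ <= _ * X]subr0.
  apply: normr_Rintegral_le => //; first exact: continuous_con_integrand.
  by move=> x _; apply: le_trans (normr_mul_cos_le _ _ _) _; exact: wM.
have smp : 0 < (s * N%:R) ^+ m by rewrite exprn_gt0// mulr_gt0.
rewrite /con_avg normrM normfV (gtr0_norm Np) ler_pdivrMl// -(ler_pM2l smp).
apply: le_trans hS _.
rewrite /M powR_mulrn_mul.
set y := m.+1%:R `^ beta.
have y0 : 0 <= y by exact: powR_ge0.
rewrite (_ : (s * N%:R) ^+ m * _ =
    (C * lam ^+ m.+1 * y ^+ m.+1) * N%:R * (N%:R * m.+1%:R)); last first.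
  rewrite !exprMn !exprVn [s ^+ m.+1]exprS [N%:R ^+ m.+1]exprS.
  by field; rewrite !expf_neq0 ?gt_eqF.
(* The bound obtained is better by a factor [N * m.+1], given away to share [superpoly_bound] with
   the discrete case. *)
rewrite ler_peMr//; last by rewrite -natrM ler1n muln_gt0 N0.
by rewrite !mulr_ge0 ?exprn_ge0// ltW.
Qed.

End Averages.

Lemma powR_nat_unbounded (R : realType) (a B : R) : 0 < a ->
  exists N0, forall N, (N0 <= N)%N -> B <= N%:R `^ a.
Proof.
move=> a0; pose b := Num.max B 1.
have b1 : 1 <= b by rewrite le_max lexx orbT.
exists (Num.trunc (b `^ a^-1)).+1 => N hN.
apply: le_trans (_ : b <= _); first by rewrite le_max lexx.
have -> : b = (b `^ a^-1) `^ a by rewrite -powRrM mulVf ?gt_eqF// powRr1// (le_trans ler01).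
rewrite ge0_ler_powR ?nnegrE ?powR_ge0 ?(ltW a0)//.
have /andP[_ h] := truncn_itv (powR_ge0 b a^-1).
by apply: ltW; apply: lt_le_trans h _; rewrite ler_nat.
Qed.

(* The number of summations by parts is [m.+1 = floor (N ^ sigma)] with
   [zeta < sigma < 1 / beta], which makes the [m.+1]-st power in
   [superpoly_bound] smaller than [exp (- 3 * m.+1)]. *)
Lemma superpoly_small (R : realType) (beta zeta : R) (V : nat -> R -> R -> R)
    (omega : R) (Delta : R -> R) :
  1 <= beta -> 0 < zeta < beta^-1 ->
  (forall x, 1 <= x -> 0 <= Delta x <= expR (x `^ zeta)) ->
  superpoly_bound R beta V omega ->
  forall delta, 0 < delta -> exists N0, forall N psi, (N0 <= N)%N ->
    Delta N%:R * `|V N omega psi| <= delta.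
Proof.
move=> beta1 /andP[z0 zb] De [K [kappa [K0 kappa0 [N1 hV]]]] delta delta0.
have beta0 : 0 < beta := lt_le_trans ltr01 beta1.
pose sigma := (zeta + beta^-1) / 2.
have [zs sb] : zeta < sigma /\ sigma < beta^-1 by split; rewrite /sigma; lra.
have sigma0 : 0 < sigma := lt_trans z0 zs.
have sb1 : sigma * beta < 1 by rewrite -ltr_pdivlMr// mul1r.
have s1 : sigma <= 1.
  by apply: ltW; apply: lt_le_trans sb _; rewrite invf_le1.
(* With [Y = N ^ sigma], this [p] gives [N ^ 3 <= Y ^ p <= p! * exp Y]. *)
pose p := (Num.trunc (3 / sigma)).+1.
have p3 : 3 <= sigma * p%:R.
  have /andP[_ h] := truncn_itv (ltW (divr_gt0 (ltr0n R 3) sigma0)).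
  by rewrite mulrC -ler_pdivrMr// ltW.
(* [N2] brings [kappa * n ^ beta / N] below [exp (- 3)]; [N3] lets [exp Y] absorb [K], [delta] and
   the factorial. *)
have [N2 h2] := powR_nat_unbounded R (1 - sigma * beta) (kappa * expR 3) ltac:(lra).
have [N3 h3] := powR_nat_unbounded R sigma (K * expR 3 * (p`!)%:R / delta) sigma0.
exists (maxn 1 (maxn N1 (maxn N2 N3))) => N psi.
rewrite !geq_max => /and4P[N0 NN1 NN2 NN3].
have Np : 0 < N%:R :> R by rewrite ltr0n.
have N1r : 1 <= N%:R :> R by rewrite ler1n.
set Y := N%:R `^ sigma.
have Y1 : 1 <= Y.
  rewrite -(powRr0 N%:R); exact: (ler_powR N1r (ltW sigma0)).
have Y0 : 0 <= Y := le_trans ler01 Y1.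
have /andP[n1 n2] := truncn_itv Y0.
have n0 : (0 < Num.trunc Y)%N by rewrite truncn_gt0.
set n := Num.trunc Y in n0 n1 n2.
have {hV} := hV N n.-1 psi NN1; rewrite prednK//.
set q := kappa * _ / _ => hV.
have q0 : 0 <= q by rewrite /q !mulr_ge0 ?invr_ge0 ?powR_ge0// ltW.
have q3 : q <= expR (- 3).
  rewrite /q ler_pdivrMr// expRN -(ler_pM2l (expR_gt0 3)) mulVKf ?gt_eqF ?expR_gt0//.
  rewrite mulrA (mulrC (expR 3)).
  apply: le_trans (_ : N%:R `^ (1 - sigma * beta) * N%:R `^ (sigma * beta) <= _); last first.
    by rewrite -powRD ?subrK ?powRr1// gt_eqF ?implybT.
  rewrite ler_pM ?powR_ge0 ?mulr_ge0 ?expR_ge0 ?(ltW kappa0) ?h2//.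
  by rewrite powRrM ge0_ler_powR ?nnegrE ?(ltW beta0).
have nN : n%:R <= N%:R :> R.
  apply: le_trans n1 _; rewrite -[leRHS]powRr1//; exact: (ler_powR N1r s1).
(* The cube is [N ^ 2] times the factor [n <= N]; the exponent comes from [n > Y - 1]. *)
have V1 : `|V N omega psi| <= K * N%:R ^+ 3 * expR (3 - 3 * Y).
  apply: le_trans hV _; apply: ler_pM.
  - by rewrite !mulr_ge0 ?exprn_ge0// ltW.
  - exact: exprn_ge0.
  - rewrite -(mulrA K) ler_wpM2l ?(ltW K0)// (exprSr _ 2) ler_wpM2l//; exact: exprn_ge0.
  apply: le_trans (_ : expR (- 3) ^+ n <= _); first by rewrite lerXn2r ?nnegrE ?expR_ge0.
  rewrite -expRM_natr ler_expR; move: n2; rewrite -natr1; lra.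
have D1 : Delta N%:R <= expR Y.
  have /andP[_ h] := De _ N1r; apply: le_trans h _; rewrite ler_expR.
  exact: (ler_powR N1r (ltW zs)).
have D0 : 0 <= Delta N%:R by have /andP[] := De _ N1r.
have N3Y : N%:R ^+ 3 <= (p`!)%:R * expR Y.
  have := expR_ge1Dxn (Num.trunc (3 / sigma)) Y0; rewrite -/p => h.
  apply: le_trans (_ : Y ^+ p <= _); last first.
    rewrite -ler_pdivrMl ?ltr0n ?fact_gt0// mulrC; apply: le_trans h.
    by rewrite lerDr.
  rewrite /Y -!powR_mulrn ?powR_ge0// -powRrM; exact: (ler_powR N1r p3).
(* Of the decay [exp (- 3 * Y)], one factor pays for [Delta], one for [N ^ 3], and the last beats
   the constants. *)
apply: le_trans (ler_pM D0 (normr_ge0 _) D1 V1) _.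
have eY := expR_ge1Dx Y.
have -> : expR (3 - 3 * Y) = expR 3 * (expR Y)^-1 ^+ 3.
  by rewrite expRD -expRN -expRM_natr; congr (_ * expR _); ring.
have Ey0 := expR_gt0 Y.
apply: le_trans (_ : K * expR 3 * (p`!)%:R / expR Y <= _).
  rewrite (_ : K * expR 3 * _ / _ =
    expR Y * (K * ((p`!)%:R * expR Y) * (expR 3 * (expR Y)^-1 ^+ 3))); last first.
    by field; rewrite gt_eqF.
  rewrite ler_wpM2l ?(ltW Ey0)// ler_wpM2r ?mulr_ge0 ?exprn_ge0 ?invr_ge0 ?expR_ge0//.
  by rewrite ler_wpM2l// ltW.
rewrite ler_pdivrMr// (mulrC delta) -ler_pdivrMr//.
by apply: le_trans (h3 _ NN3) _; apply: le_trans eY; rewrite lerDr.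
Qed.

(** * Almost every rotation is resonant *)

Section Dirichlet.
Variable R : realType.

(** Pigeonhole: [Q.+1] fractional parts in [Q] boxes of length [1 / Q]. *)
Lemma dirichlet (x : R) (Q : nat) : (0 < Q)%N ->
  exists (q : nat) (p : int), [/\ (0 < q)%N, (q <= Q)%N &
    `|q%:R * x - p%:~R| <= Q%:R^-1].
Proof.
move=> Q0; have Qp : 0 < Q%:R :> R by rewrite ltr0n.
pose fl (i : nat) := Num.floor (i%:R * x).
pose fr (i : nat) := i%:R * x - (fl i)%:~R.
have fr01 i : 0 <= fr i < 1.
  have /andP[h1 h2] := floor_itv (i%:R * x).
  by rewrite /fr subr_ge0 h1 ltrBlDl addrC; rewrite intrD in h2; rewrite addrC.
have bxP i : (Num.trunc (Q%:R * fr i) < Q)%N.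
  have /andP[f0 f1] := fr01 i.
  have /andP[h _] := truncn_itv (mulr_ge0 (ltW Qp) f0).
  by rewrite -(ltr_nat R) (le_lt_trans h)// gtr_pMr.
pose bx (i : 'I_Q.+1) := Ordinal (bxP i).
have [i [j [ij bij]]] : exists i j : 'I_Q.+1, (i < j)%N /\ bx i = bx j.
  have /injectivePn[i [j ij e]] : ~~ injectiveb bx.
    apply/negP => /injectiveP/leq_card; by rewrite !card_ord ltnn.
  have [lij|lji|/val_inj e'] := ltngtP i j.
  - by exists i, j.
  - by exists j, i.
  - by rewrite e' eqxx in ij.
exists (j - i)%N, (fl j - fl i); split.
- by rewrite subn_gt0.
- by rewrite (leq_trans (leq_subr _ _))// -ltnS.
have -> : (j - i)%:R * x - (fl j - fl i)%:~R = fr j - fr i.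
  by rewrite natrB 1?ltnW// intrB /fr; ring.
have /andP[fi0 _] := fr01 i; have /andP[fj0 _] := fr01 j.
have /andP[hi1 hi2] := truncn_itv (mulr_ge0 (ltW Qp) fi0).
have /andP[hj1 hj2] := truncn_itv (mulr_ge0 (ltW Qp) fj0).
have e : Num.trunc (Q%:R * fr i) = Num.trunc (Q%:R * fr j) :> nat by case: bij.
rewrite -e in hj1 hj2; rewrite -natr1 in hi2; rewrite -natr1 in hj2.
rewrite -(ler_pM2l Qp) divff ?gt_eqF// -{1}(gtr0_norm Qp) -normrM mulrBr.
by rewrite ler_norml; apply/andP; split; lra.
Qed.

(* Valid for rational [x] as well: if the approximation given by [dirichlet] has
   a small denominator, a multiple of it is used. *)
Lemma dirichlet_unbounded (x : R) (K : nat) :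
  exists (q : nat) (p : int), [/\ (0 < q)%N, (K <= q)%N &
    `|q%:R * x - p%:~R| <= q%:R^-1].
Proof.
pose L := K.+1.
(* With the cube, a denominator [q < L] can be replaced by [L * q]: the error is at most
   [L / L ^ 3], below [1 / (L * q)]. *)
have [q [p [q0 qQ h]]] := dirichlet x (L * L * L)%N ltac:(by []).
have qp : 0 < q%:R :> R by rewrite ltr0n.
have Lp : 0 < L%:R :> R by rewrite ltr0n.
have [Lq|qL] := leqP L q.
  exists q, p; split=> //; first exact: ltnW.
  by apply: (le_trans h); rewrite lef_pV2 ?posrE ?ltr0n// ler_nat.
exists (L * q)%N, (L%:Z * p); split.
- by rewrite muln_gt0 q0.
- by rewrite (leq_trans (leqnSn K))// leq_pmulr.
rewrite natrM intrM -[L%:Z%:~R]/(L%:R) -!mulrA -mulrBr normrM ger0_norm//.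
apply: (le_trans (ler_wpM2l (ler0n _ _) h)).
rewrite -!natrM -(ler_pM2l Lp) mulrA.
apply: (@le_trans _ _ L%:R^-1).
  by rewrite !natrM le_eqVlt; apply/orP; left; apply/eqP; field; rewrite gt_eqF.
rewrite !natrM invfM mulVKf ?gt_eqF// lef_pV2 ?posrE// ler_nat.
exact: ltnW.
Qed.

End Dirichlet.

(** * Null sets by Lebesgue density *)

Section Density.
Variable R : realType.
Local Notation mu := (@lebesgue_measure R).

(** Almost every point of [S] is a density point, but gaps of relative size [theta] at arbitrarily
    small scales keep the density at most [1 - theta]. *)
Lemma null_of_scaled_gaps (S : set R) (theta : R) : measurable S ->
  0 < theta -> theta < 1 ->
  (forall y d : R, S y -> 0 < d -> exists r z, [/\ 0 < r, r < d,
     ball z (theta * r) `<=` ball y r & ball z (theta * r) `&` S = set0]) ->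
  mu S = 0.
Proof.
move=> mS t0 t1 gaps.
have := lebesgue_density mS; rewrite -/mu => -[N [mN N0 NS]].
apply/eqP; rewrite eq_le measure_ge0 andbT -N0.
apply: le_measure; rewrite ?inE// => y Sy; apply: NS => /= dens.
rewrite indicE mem_set// in dens.
have {dens} : \forall r \near 0^'+,
    1 - theta < fine (mu (S `&` ball y r) * (mu (ball y r))^-1)%E.
  have /fine_cvgP[_ h] := dens.
  by apply: (cvgr_gt _ h); rewrite /= gtrBl.
move=> [d /= d0 hd].
have [r [z [r0 rd sub dis]]] := gaps y d Sy d0.
have tr0 : 0 < theta * r by apply: mulr_gt0.
have := hd r; rewrite /= sub0r normrN gtr0_norm// => /(_ rd r0).
apply/negP; rewrite -leNgt.
have mB : mu (ball y r) = (r *+ 2)%:E by apply: lebesgue_measure_ball; exact: ltW.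
have mB' : mu (ball z (theta * r)) = ((theta * r) *+ 2)%:E.
  by apply: lebesgue_measure_ball; exact: ltW.
have mSB : measurable (S `&` ball y r) by apply: measurableI => //; exact: measurable_ball.
have h : (mu (S `&` ball y r) + ((theta * r) *+ 2)%:E <= (r *+ 2)%:E)%E.
  rewrite -mB -mB' -measureU//.
  - apply: le_measure; rewrite ?inE.
    + by apply: measurableU => //; exact: measurable_ball.
    + exact: measurable_ball.
    by move=> u [[]|/sub].
  - exact: measurable_ball.
  - by rewrite -setIA [X in _ `&` X]setIC setIA [X in X `&` _]setIC dis set0I.
have fin : mu (S `&` ball y r) \is a fin_num.
  rewrite ge0_fin_numE//; apply: le_lt_trans (ltry (r *+ 2)); apply: le_trans h.
  by rewrite leeDl// lee_fin mulrn_wge0// ltW.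
move: h; rewrite mB -(fineK fin); set s := fine _ => h.
have r2 : r *+ 2 != 0 by rewrite mulrn_eq0/= gt_eqF.
rewrite inver (negbTE r2) -EFinM/= ler_pdivrMr; last by rewrite pmulrn_lgt0.
by move: h; rewrite -EFinD lee_fin mulrBl mul1r mulrnAr lerBrDr.
Qed.

End Density.

Section Resonance.
Variable R : realType.
Local Notation mu := (@lebesgue_measure R).

(** One form for both problems: [(1, rho)] gives [q * rho - p], and a pair [rho] gives the pairing
    of [(- p, q)] with it. *)
Definition linear_form (q : nat) (p : int) (z : R * R) : R := q%:R * z.2 - p%:~R * z.1.

Lemma measurable_linear_form q p : measurable_fun [set: R * R] (linear_form q p).
Proof.
apply: measurable_funB; apply: measurable_funM => //.
Qed.

Definition close_approx (c : R) (K : nat) : set (R * R) :=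
  \bigcup_(i : nat * int) [set z | [/\ (0 < i.1)%N, (K <= i.1)%N &
    i.1%:R * `|linear_form i.1 i.2 z| < c]].

Lemma measurable_close_approx c K : measurable (close_approx c K).
Proof.
apply: countable_bigcupT_measurable => [|[q p] /=]; first exact: countableP.
have [/andP[q0 Kq]|nq] := boolP ((0 < q)%N && (K <= q)%N); last first.
  rewrite (_ : [set z | _] = set0) ?measurable0//.
  by apply/seteqP; split => // z [q0 Kq _]; move: nq; rewrite q0 Kq.
rewrite (_ : [set z | _] = (fun z => q%:R * `|linear_form q p z|) @^-1` `]-oo, c[%classic).
  rewrite -[X in measurable X]setTI.
  have mf : measurable_fun [set: R * R] (fun z => q%:R * `|linear_form q p z|).
    apply: measurable_funM => //; apply: measurableT_comp => //.
    exact: measurable_linear_form.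
  exact: mf.
apply/seteqP; split => [z [_ _ lt]|z] /=; rewrite in_itv/= => // lt; by split.
Qed.

(* Dirichlet's theorem puts, at distance at most [|x| / q^2] from every [y], a
   point around which a gap of length comparable to [1 / q^2] is free of the set,
   so that the set has no density point. *)
Lemma close_approx_section c K (x : R) : x != 0 -> 0 < c ->
  mu (xsection (~` close_approx c K) x) = 0.
Proof.
move=> x0 c0.
have mS : measurable (xsection (~` close_approx c K) x).
  by apply: measurable_xsection; apply: measurableC; exact: measurable_close_approx.
(* The bound by [c / |x|] puts the gap inside [close_approx], and [e <= 1] makes it fit into the
   ball around [y]. *)
pose e := Num.min (c / `|x|) 1.
have ax : 0 < `|x| by rewrite normr_gt0.
have e0 : 0 < e by rewrite lt_min ltr01 divr_gt0.
have e1 : e <= 1 by rewrite ge_min lexx orbT.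
have ec : e * `|x| <= c by rewrite -ler_pdivlMr// ge_min lexx.
apply: (@null_of_scaled_gaps _ _ (e / 2)) => //; [lra|lra|].
move=> y d Sy d0.
have dx0 : 0 < 2 * `|x| / d by rewrite !mulr_gt0 ?invr_gt0.
have [q [p [q0 Kq h]]] := dirichlet_unbounded R (y / x) (maxn K (Num.trunc (2 * `|x| / d)).+1).
move: Kq; rewrite geq_max => /andP[Kq dq].
have qp : 0 < q%:R :> R by rewrite ltr0n.
have qd : 2 * `|x| < d * q%:R.
  rewrite -ltr_pdivrMl// mulrC.
  have /andP[_ hh] := truncn_itv (ltW dx0).
  by apply: lt_le_trans hh _; rewrite ler_nat.
have q1 : 1 <= q%:R :> R by rewrite ler1n.
(* Twice the distance [|x| / q ^ 2] given by Dirichlet: half reaches the centre [z] of the gap,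
   where the linear form vanishes, and half holds the gap. *)
pose r := 2 * `|x| / q%:R ^+ 2.
have r0 : 0 < r by rewrite !mulr_gt0 ?invr_gt0 ?exprn_gt0.
pose z := p%:~R * x / q%:R.
have er : e / 2 * r = e * `|x| / q%:R ^+ 2 by rewrite /r; field; rewrite gt_eqF.
have zy : `|z - y| <= `|x| / q%:R ^+ 2.
  rewrite (_ : z - y = - ((q%:R * (y / x) - p%:~R) * (x / q%:R))); last first.
    by rewrite /z; field; rewrite x0 gt_eqF.
  rewrite normrN normrM normf_div (gtr0_norm qp).
  apply: le_trans (ler_wpM2r _ h) _; first by rewrite divr_ge0// ltW.
  by rewrite le_eqVlt; apply/orP; left; apply/eqP; field; rewrite gt_eqF.
have er2 : e / 2 * r <= `|x| / q%:R ^+ 2.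
  by rewrite er ler_wpM2r ?invr_ge0 ?exprn_ge0// ler_piMl// ltW.
exists r, z; split => //.
- rewrite /r ltr_pdivrMr ?exprn_gt0//; apply: lt_le_trans qd _.
  by rewrite ler_wpM2l ?(ltW d0)// expr2 ler_peMl// ltW.
- move=> u /=; rewrite /ball/= => uz.
  have -> : y - u = (z - u) - (z - y) by ring.
  apply: le_lt_trans (ler_normB _ _) _.
  have rE : r = `|x| / q%:R ^+ 2 + `|x| / q%:R ^+ 2 by rewrite /r; ring.
  by rewrite rE; apply: ltr_leD => //; exact: lt_le_trans uz er2.
- apply/seteqP; split => // u [/=]; rewrite /ball/= er => uz.
  rewrite /xsection/= inE => -[]; exists (q, p) => //=; split => //.
  rewrite /linear_form/= (_ : _ - _ = - (q%:R * (z - u))); last first.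
    by rewrite /z; field; rewrite gt_eqF.
  rewrite normrN normrM (gtr0_norm qp) mulrA -expr2.
  move: uz; rewrite ltr_pdivlMr ?exprn_gt0// => uz.
  by rewrite mulrC; apply: lt_le_trans uz ec.
Qed.

(** The first clause makes some frequencies nearly resonant; the second keeps each single frequency
    off exact resonance, so that its averages decay. *)
Definition resonant (z : R * R) : Prop :=
  (forall c K, 0 < c -> close_approx c K z) /\
  (forall q p, (0 < q)%N -> linear_form q p z != 0).

Lemma linear_form_section q p (x : R) : (0 < q)%N ->
  mu (xsection [set z | linear_form q p z = 0] x) = 0.
Proof.
move=> q0; apply: countable_lebesgue_measure0.
apply: (@sub_countable _ _ _ [set p%:~R * x / q%:R]); last exact: countable1.
apply: subset_card_le => y; rewrite /xsection/= inE /linear_form/= => /eqP.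
by rewrite subr_eq0 => /eqP <-; rewrite mulrAC divff ?mul1r// pnatr_eq0 -lt0n.
Qed.

Lemma measurable_linear_form_eq0 q p : measurable [set z | linear_form q p z = 0].
Proof.
rewrite (_ : [set z | _] = linear_form q p @^-1` [set 0])//.
rewrite -[X in measurable X]setTI.
by apply: measurable_linear_form.
Qed.

(** Countably many conditions, since null sets are only stable under countable unions. *)
Lemma resonant_of_nat z :
  (forall j K, close_approx (j.+1%:R^-1) K z) ->
  (forall n, if unpickle n is Some (q, p) then (0 < q)%N -> linear_form q p z != 0
             else True) ->
  resonant z.
Proof.
move=> h1 h2; split => [c K c0|q p q0]; last first.
  by have := h2 (pickle (q, p)); rewrite pickleK; exact.
have ci0 : 0 <= c^-1 by rewrite invr_ge0 ltW.
have [[q p] _ [q0 Kq h]] := h1 (Num.trunc c^-1) K.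
exists (q, p) => //; split => //; apply: lt_trans h _.
rewrite -[ltRHS]invrK ltf_pV2 ?posrE ?invr_gt0 ?ltr0n//.
by have /andP[] := truncn_itv ci0.
Qed.

Lemma ae_resonant_section (x : R) : x != 0 -> \forall y \ae mu, resonant (x, y).
Proof.
move=> x0.
have h1 : \forall y \ae mu, forall j K, close_approx (j.+1%:R^-1) K (x, y).
  apply: ae_foralln => j; apply: ae_foralln => K.
  exists (xsection (~` close_approx (j.+1%:R^-1) K) x); split.
  - by apply: measurable_xsection; apply: measurableC; exact: measurable_close_approx.
  - by apply: close_approx_section.
  - by move=> y /= h; rewrite /xsection/= inE.
have h2 : \forall y \ae mu, forall n, if unpickle n is Some (q, p) then
    (0 < q)%N -> linear_form q p (x, y) != 0 else True.
  apply: ae_foralln => n; case: unpickle => [[q p]|]; last exact: aeW.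
  have [->|q0] := posnP q; first exact: aeW.
  exists (xsection [set z | linear_form q p z = 0] x); split.
  - by apply: measurable_xsection; exact: measurable_linear_form_eq0.
  - exact: linear_form_section.
  - move=> y /= h; rewrite /xsection/= inE/=; apply: contra_notP h => /eqP h _.
    exact: h.
apply: (@filterS2 _ _ (ae_filter_ringOfSetsType mu)) h1 h2 => y.
exact: resonant_of_nat.
Qed.

(** Fubini; the line over [x = 0] is left out because Dirichlet's bound is rescaled by [x] in
    [close_approx_section]. *)
Lemma product_measure_null (A : set (R * R)) : measurable A ->
  (forall x, x != 0 -> mu (xsection A x) = 0) -> (mu \x mu)%E A = 0.
Proof.
move=> mA A0; rewrite /product_measure1.
rewrite (@ae_eq_integral _ _ _ mu setT (cst 0%E))//.
- by rewrite integral0.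
- exact: measurable_fun_xsection.
- exists [set 0]; split; first exact: measurable_set1.
    exact: lebesgue_measure_set1.
  move=> x /=; apply: contra_notP => /eqP x0 _.
  exact: A0.
Qed.

Lemma ae_resonant : \forall z \ae (mu \x mu)%E, resonant z.
Proof.
have h1 : \forall z \ae (mu \x mu)%E, forall j K, close_approx (j.+1%:R^-1) K z.
  apply: ae_foralln => j; apply: ae_foralln => K.
  exists (~` close_approx (j.+1%:R^-1) K); split => //.
  - by apply: measurableC; exact: measurable_close_approx.
  - apply: product_measure_null => [|x x0]; last exact: close_approx_section.
    by apply: measurableC; exact: measurable_close_approx.
have h2 : \forall z \ae (mu \x mu)%E, forall n, if unpickle n is Some (q, p) then
    (0 < q)%N -> linear_form q p z != 0 else True.
  apply: ae_foralln => n; case: unpickle => [[q p]|]; last exact: aeW.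
  have [->|q0] := posnP q; first exact: aeW.
  exists [set z | linear_form q p z = 0]; split.
  - exact: measurable_linear_form_eq0.
  - apply: product_measure_null => [|x _]; first exact: measurable_linear_form_eq0.
    exact: linear_form_section.
  - by move=> z /= h; apply: contra_notP h => /eqP h _; exact: h.
apply: (@filterS2 _ _ (ae_filter_ringOfSetsType (mu \x mu)%E)) h1 h2 => z.
exact: resonant_of_nat.
Qed.

End Resonance.

(** * Sparse observables *)

(** Each element already chosen asks only that the next one be large, so the maximum of finitely
    many thresholds serves them all. The index [n] enters [Q] so that the requirements may tighten
    as the sequence grows. *)
Lemma sparse_selection (T : Type) (P : T -> Prop) (size : T -> nat)
    (Q : nat -> T -> nat -> T -> Prop) :
  (forall B, exists2 t, P t & (B <= size t)%N) ->
  (forall m x n, P x -> exists B, forall y, P y -> (B <= size y)%N -> Q m x n y) ->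
  exists k : nat -> T, (forall n, P (k n)) /\
    (forall m n, (m < n)%N -> Q m (k m) n (k n)).
Proof.
move=> sup hQ.
have /choice[pick hpick] B : exists t, P t /\ (B <= size t)%N.
  by have [t ? ?] := sup B; exists t.
have /choice[bnd hbnd] (i : nat * T * nat) : exists B, P i.1.2 ->
    forall y, P y -> (B <= size y)%N -> Q i.1.1 i.1.2 i.2 y.
  move: i => [[m x] n] /=; have [Px|nPx] := pselect (P x); last by exists 0%N.
  by have [B hB] := hQ m x n Px; exists B.
pose t0 := pick 0%N.
pose bound (s : seq T) := \max_(m < seq.size s) bnd (m : nat, nth t0 s m, seq.size s).
pose next (s : seq T) := pick (bound s).
pose pre := fix pre n := if n is n'.+1 then rcons (pre n') (next (pre n')) else [::].
have spre n : seq.size (pre n) = n by elim: n => //= n IH; rewrite size_rcons IH.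
pose k n := next (pre n).
have npre m n : (m < n)%N -> nth t0 (pre n) m = k m.
  elim: n => // n IH; rewrite ltnS leq_eqVlt => /predU1P[->|mn] /=.
    by rewrite nth_rcons spre ltnn eqxx.
  by rewrite nth_rcons spre mn IH.
have Pk n : P (k n) by have [] := hpick (bound (pre n)).
exists k; split => // m n mn.
apply: (hbnd (m, k m, n) (Pk m) (k n) (Pk n)).
have [_] := hpick (bound (pre n)).
rewrite /bound; apply: leq_trans.
have mn' : (m < seq.size (pre n))%N by rewrite spre.
have := @leq_bigmax _ (fun m : 'I__ =>
  bnd (m : nat, nth t0 (pre n) m, seq.size (pre n))) (Ordinal mn').
by rewrite /= npre// spre.
Qed.

Section SparseObservable.
Variables (R : realType) (d : nat) (Delta : R -> R).
Hypothesis aD : approximation_function Delta.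
Hypothesis gs : gauge_summable Delta d 0.
Variables (V : nat -> R -> R -> R) (Omega : 'rV[int]_d -> R).
Hypothesis V1 : forall N omega psi, `|V N omega psi| <= 1.

(** The norm as a natural number: the time at which the mode is tested. *)
Definition height (k : 'rV[int]_d) : nat := `|(`|k| : int)|%N.

Lemma heightE k : `|k|%:~R = (height k)%:R :> R.
Proof. by rewrite /height natr_absz normr_id. Qed.

(* [V N omega psi] stands for the weighted average over the time [N] of
   [s |-> cos (2 pi omega s + psi)], and [Omega k] for [<k, rho>]. *)
Definition suitable (k : 'rV[int]_d) : Prop :=
  [/\ k != 0,
      forall psi, `|V (height k) (Omega k) psi - cos psi| <= 1 / 8
    & forall delta, 0 < delta -> exists N0, forall N psi, (N0 <= N)%N ->
        Delta N%:R * `|V N (Omega k) psi| <= delta].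

Hypothesis sup : forall B, exists2 k, suitable k & (B <= height k)%N.

Let height_gt0 k : k != 0 -> 1 <= (height k)%:R :> R.
Proof. by move=> k0; rewrite -heightE normr_int_ge1. Qed.

(** Interference is small for two different reasons. An earlier mode has a decaying average; a later
    one has a small amplitude, and its average is at most 1. *)
Lemma sparse_frequencies : exists k : nat -> 'rV[int]_d,
  [/\ forall n, suitable (k n),
      forall m n, (m < n)%N -> `|k m| < `|k n|
    & forall m n psi, m != n -> `|2 * gauge Delta (k m) *
        V (height (k n)) (Omega (k m)) psi| <= gauge Delta (k n) / 2 / 2 ^+ m.+1].
Proof.
pose Q (m : nat) (x : 'rV[int]_d) (n : nat) (y : 'rV[int]_d) := [/\ `|x| < `|y|,
  forall psi, `|2 * gauge Delta x * V (height y) (Omega x) psi| <=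
    gauge Delta y / 2 / 2 ^+ m.+1 &
  2 * gauge Delta y <= gauge Delta x / 2 / 2 ^+ n.+1].
have [] := @sparse_selection _ suitable height Q sup.
  move=> m x n [x0 _ small].
  have Dx := approximation_function_gt0 R Delta aD _ (height_gt0 _ x0).
  set D := Delta _ in Dx.
  (* Chosen so that [2 / D] times this, divided by [Delta] at the new time, is the required
     bound. *)
  have d0 : 0 < D / 4 / 2 ^+ m.+1 by rewrite !divr_gt0// exprn_gt0.
  have [N1 h1] := small _ d0.
  have [_ _ _ cD] := aD.
  have [A [_ hA]] := (cvgryPge Delta).1 cD (4 * 2 ^+ n.+1 * D).
  exists (maxn (height x).+1 (maxn N1 (Num.trunc A).+1)) => y [y0 _ _].
  rewrite !geq_max => /and3P[xy N1y Ay].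
  have Dy := approximation_function_gt0 R Delta aD _ (height_gt0 _ y0).
  have gx : gauge Delta x = D^-1 by rewrite /gauge heightE.
  have gy : gauge Delta y = (Delta (height y)%:R)^-1 by rewrite /gauge heightE.
  split.
  - by rewrite -(ltr_int R) !heightE ltr_nat.
  - move=> psi; rewrite gx gy normrM ger0_norm ?mulr_ge0 ?invr_ge0 ?(ltW Dx)//.
    have := h1 _ psi N1y; rewrite -ler_pdivlMl// => h.
    apply: (le_trans (ler_wpM2l _ h)); first by rewrite mulr_ge0 ?invr_ge0 ?(ltW Dx).
    rewrite le_eqVlt; apply/orP; left; apply/eqP; field.
    by rewrite !gt_eqF ?exprn_gt0.
  - have hD : 4 * 2 ^+ n.+1 * D <= Delta (height y)%:R.
      apply: hA; have [A0|A0] := leP 0 A; last by apply: lt_le_trans A0 _.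
      have /andP[_ h] := truncn_itv A0; apply: lt_le_trans h _.
      by rewrite ler_nat.
    rewrite gx gy ler_pdivrMr// -(ler_pM2l Dx).
    rewrite (_ : D * (_ * _) = Delta (height y)%:R / (2 * 2 ^+ n.+1)).
      rewrite ler_pdivlMr ?mulr_gt0 ?exprn_gt0//; apply: le_trans hD.
      by rewrite le_eqVlt; apply/orP; left; apply/eqP; ring.
    by field; rewrite !gt_eqF ?exprn_gt0.
move=> k [sk Qk]; exists k; split => // [m n /Qk[]//|m n psi].
rewrite neq_ltn => /orP[/Qk[_ + _]|/Qk[_ _ h]]; first exact.
have [k0 _ _] := sk m; have g0 := gauge_gt0 R d Delta aD _ k0.
apply: le_trans h; rewrite normrM ger0_norm ?mulr_ge0 ?(ltW g0)//.
by rewrite ler_piMr// mulr_ge0// ltW.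
Qed.

Variables (l : nat) (err : ('rV[R]_d -> 'rV[R]_l) -> 'rV[R]_d -> nat -> R).
Hypothesis errE : forall (a : nat -> R) k phi theta N i, (0 < N)%N ->
  cvgn (series (fun n => `|a n|)) -> (forall n, k n != 0) ->
  `|limn (series (fun n =>
      a n * V N (Omega (k n)) (2 * pi * pairing (k n) theta + phi n i)))|
    <= err (trig_observable R d l a k phi) theta N.

(** The frequencies are fixed before the phases, whose choice may thus depend on them; no estimate
    on interference involves the phases. *)
Lemma sparse_observable : exists k : nat -> 'rV[int]_d,
  [/\ forall n, (0 < height (k n))%N,
      forall m n, (m < n)%N -> (height (k m) < height (k n))%N
    & forall phi : nat -> 'I_l -> R, exists2 f, observable Delta f &
      forall n theta i, 1 / 2 <= `|cos (2 * pi * pairing (k n) theta + phi n i)| ->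
        1 / (4 * Delta (height (k n))%:R) <= err f theta (height (k n))].
Proof.
have [k [sk kincr hk]] := sparse_frequencies.
have k0 n : k n != 0 by case: (sk n).
exists k; split.
- by move=> n; rewrite -(ler1n R) height_gt0.
- by move=> m n /kincr; rewrite -(ltr_int R) !heightE ltr_nat.
move=> phi; exists (trig_observable R d l (fun n => 2 * gauge Delta (k n)) k phi).
  exact: trig_observable_observable.
move=> n theta i.
set psi := fun n => 2 * pi * pairing (k n) theta + phi n i.
rewrite -/(psi n) => cn.
have ca : cvgn (series (fun n => `|2 * gauge Delta (k n)|)).
  have := gauge_summable_freq R d Delta k aD k0 kincr 0 gs.
  move=> /(@is_cvg_seriesZ _ _ 2).
  rewrite (_ : 2 *: _ = fun n => `|2 * gauge Delta (k n)|)//.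
  apply/funext => m; rewrite ger0_norm ?mulr_ge0 ?(ltW (gauge_gt0 _ _ _ aD _ _))//.
  by rewrite -[in RHS](mulr1 (gauge _ _)).
have hn0 : (0 < height (k n))%N by rewrite -(ler1n R) height_gt0.
apply: le_trans (errE _ k phi theta (height (k n)) i hn0 ca k0).
set S := limn _.
have g0 := gauge_gt0 R d Delta aD _ (k0 n).
have iso : `|S - 2 * gauge Delta (k n) * V (height (k n)) (Omega (k n)) (psi n)|
    <= gauge Delta (k n) / 2.
  by apply: series_isolated_term => m mn; exact: hk.
have [_ res _] := sk n; have {}res := res (psi n).
have -> : 1 / (4 * Delta (height (k n))%:R) = gauge Delta (k n) / 4.
  by rewrite /gauge heightE invfM mul1r mulrC.
set g := gauge Delta (k n) in g0 iso *.
set v := V _ _ _ in iso res.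
set c := cos _ in cn res.
have h1 : `|2 * g * v - 2 * g * c| <= g / 4.
  rewrite -mulrBr normrM ger0_norm ?mulr_ge0 ?(ltW g0)//.
  apply: (le_trans (ler_wpM2l _ res)); first by rewrite mulr_ge0// ltW.
  by rewrite le_eqVlt; apply/orP; left; apply/eqP; field.
have h2 : g <= `|2 * g * c|.
  rewrite normrM ger0_norm ?mulr_ge0 ?(ltW g0)//.
  apply: le_trans (ler_wpM2l _ cn); last by rewrite mulr_ge0// ltW.
  by rewrite le_eqVlt; apply/orP; left; apply/eqP; field.
have h3 : `|2 * g * c| <= `|S| + `|S - 2 * g * v| + `|2 * g * v - 2 * g * c|.
  have e : S - (S - 2 * g * v) - (2 * g * v - 2 * g * c) = 2 * g * c by ring.
  rewrite -{1}e.
  apply: le_trans (ler_normB _ _) _; rewrite lerD2r; exact: ler_normB.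
clear - g0 iso h1 h2 h3; lra.
Qed.

(** The phase of mode [n] makes its cosine equal to 1 at [vartheta n]. Letting the test point vary
    with [n] is what serves a whole dense set. *)
Lemma sparse_pointwise (vartheta : nat -> 'rV[R]_d) : (0 < l)%N ->
  exists2 f, observable Delta f & exists N : nat -> nat,
    [/\ forall n, (0 < N n)%N, forall m n, (m < n)%N -> (N m < N n)%N &
        forall n, 1 / (4 * Delta (N n)%:R) <= err f (vartheta n) (N n)].
Proof.
move=> l0; have [k [h0 hincr hk]] := sparse_observable.
have [f fobs hf] := hk (fun n _ => - (2 * pi * pairing (k n) (vartheta n))).
exists f => //; exists (height \o k); split => // n.
apply: (hf n _ (Ordinal l0)); rewrite subrr cos0 normr1; lra.
Qed.

(** The first two components carry the cosine and the sine of the same angle, and their squares add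
    up to 1, so one of the two is at least [1 / 2] in absolute value. *)
Lemma sparse_uniform : (1 < l)%N ->
  exists2 f, observable Delta f & exists N : nat -> nat,
    [/\ forall n, (0 < N n)%N, forall m n, (m < n)%N -> (N m < N n)%N &
        forall n theta, 1 / (4 * Delta (N n)%:R) <= err f theta (N n)].
Proof.
move=> l1; have [k [h0 hincr hk]] := sparse_observable.
have [f fobs hf] := hk (fun _ i => if i == 0%N :> nat then 0 else - (pi / 2)).
exists f => //; exists (height \o k); split => // n theta.
set u := 2 * pi * pairing (k n) theta.
have [cu|cu] := leP (1 / 2) `|cos u|.
  by apply: (hf n _ (Ordinal (ltnW l1))); rewrite /= addr0.
apply: (hf n _ (Ordinal l1)); rewrite /= cosBpihalf -/u leNgt; apply/negP => su.
have h x : `|x| < 1 / 2 -> x ^+ 2 < 1 / 4 :> R.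
  move=> x2; rewrite -real_normK ?num_real// (_ : 1 / 4 = (1 / 2) ^+ 2); last by field.
  by rewrite ltrXn2r.
have := ltrD (h _ cu) (h _ su); rewrite cos2Dsin2; apply/negP; rewrite -leNgt; lra.
Qed.

End SparseObservable.

(** * The discrete and the continuous averages *)

Section ErrorFormulas.
Variables (R : realType) (beta : R) (w : R -> R).
Hypothesis wc : weight_class beta w.
Variables (d l : nat) (a : nat -> R) (k : nat -> 'rV[int]_d) (phi : nat -> 'I_l -> R).
Hypothesis ca : cvgn (series (fun n => `|a n|)).
Hypothesis k0 : forall n, k n != 0.
Local Notation f := (trig_observable R d l a k phi).

Lemma error_dis_ge (rho theta : 'rV[R]_d) (N : nat) (i : 'I_l) :
  `|limn (series (fun n => a n * dis_avg R w N (pairing (k n) rho)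
      (2 * pi * pairing (k n) theta + phi n i)))| <= error_dis w f rho theta N.
Proof.
rewrite /error_dis torus_vintegral_trig_observable// subr0.
apply: le_trans (normr_coord_le _ _ _ i); rewrite !mxE summxE.
rewrite le_eqVlt; apply/orP; left; apply/eqP; congr `|_|.
pose u (n m : nat) := a m * cos (2 * pi * pairing (k m) rho * n%:R +
  (2 * pi * pairing (k m) theta + phi m i)).
have fE n : (w (n%:R / N%:R) *: f (rotation rho n%:R theta)) 0 i =
    w (n%:R / N%:R) * (limn (series (u n)) : R).
  rewrite !mxE /trig_series; congr (_ * _); congr (limn (series _)); apply/funext => m.
  by rewrite /rotation pairingDr pairingZr /u; congr (_ * cos _); ring.
rewrite (eq_bigr _ (fun n _ => fE n)) /dis_avg.
apply: cvg_lim => //.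
have cu n : cvgn (series (u n)).
  by apply: dominated_series_cvg ca => m; exact: normr_mul_cos_le.
rewrite (_ : series _ = fun M => (weight_sum w N)^-1 *
    \sum_(0 <= n < N) (w (n%:R / N%:R) * series (u n) M)).
  apply: cvgM; first exact: cvg_cst.
  apply: cvg_big => [|n _]; first exact: add_continuous.
  by apply: cvgM; [exact: cvg_cst|exact: cu].
apply/funext => M; rewrite /series/=.
under eq_bigr do rewrite mulrCA.
rewrite -mulr_sumr; congr (_ * _).
under eq_bigr do rewrite mulr_sumr.
rewrite exchange_big/=; apply: eq_bigr => n _.
by rewrite mulr_sumr; apply: eq_bigr => m _; rewrite /u mulrCA.
Qed.

Lemma error_con_ge (rho theta : 'rV[R]_d) (N : nat) (i : 'I_l) : (0 < N)%N ->
  `|limn (series (fun n => a n * con_avg R w N (pairing (k n) rho)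
      (2 * pi * pairing (k n) theta + phi n i)))| <= error_con w f rho theta N%:R.
Proof.
move=> N0; have Np : 0 < N%:R :> R by rewrite ltr0n.
rewrite /error_con torus_vintegral_trig_observable// subr0.
apply: le_trans (normr_coord_le _ _ _ i); rewrite !mxE.
rewrite le_eqVlt; apply/orP; left; apply/eqP; congr `|_|.
have [C [lam [C0 lam0 wM]]] := weight_bound _ _ _ wc.
set c := fun n => a n * _.
pose h n (s : R) := a n * (w (s / N%:R) * cos (2 * pi * pairing (k n) rho * s +
  (2 * pi * pairing (k n) theta + phi n i))).
have ch n : continuous (h n).
  move=> s; apply: cvgM; first exact: cvg_cst.
  exact: (continuous_con_integrand _ _ _ wc N 0).
have hE n : \int[lebesgue_measure]_(s in `[0, N%:R]) h n s = N%:R * c n.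
  rewrite /h RintegralZl//; last first.
    by apply: continuous_integrable; exact: (continuous_con_integrand _ _ _ wc N 0).
  by rewrite /c /con_avg mulrCA mulVKf// gt_eqF.
have cc : cvgn (series c).
  apply: dominated_series_cvg ca => n; rewrite /c normrM ler_piMr//.
  exact: (con_avg_le1 _ _ _ wc).
(* A uniform bound on [w], dominating the series for termwise integration. *)
pose M := C * lam ^+ 1 * (1%:R `^ (1%:R * beta)).
have hM n s : `|h n s| <= `|a n| * M.
  rewrite normrM ler_wpM2l//; apply: le_trans (normr_mul_cos_le _ _ _) _.
  exact: (wM 0%N).
transitivity (N%:R^-1 *
  \int[lebesgue_measure]_(s in `[0, N%:R]) (limn (series (h^~ s)) : R)).
  rewrite (@Rintegral_dominated_series _ h (fun n => `|a n| * M))//; first last.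
    have := @is_cvg_seriesZ _ _ M ca.
    rewrite (_ : M *: _ = fun n => `|a n| * M)//.
    by apply/funext => n; exact: mulrC.
  rewrite (funext hE).
  have := @lim_seriesZ _ _ N%:R cc; rewrite /GRing.scale/= => ->.
  by rewrite mulKf// gt_eqF.
congr (_ * _); apply: eq_Rintegral => s _; rewrite mxE /trig_series.
set u := fun n => a n * cos (2 * pi * pairing (k n) (rotation rho s theta) + phi n i).
have cu : cvgn (series u).
  by apply: dominated_series_cvg ca => m; exact: normr_mul_cos_le.
have := @lim_seriesZ _ _ (w (s / N%:R)) cu; rewrite /GRing.scale/= => <-.
congr (limn (series _)); apply/funext => n; rewrite /h /u mulrCA.
congr (_ * (_ * cos _)).
by rewrite /rotation pairingDr pairingZr; ring.
Qed.

End ErrorFormulas.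

(** Reduction to the fractional part goes through [cos (2 * pi * x)], which has period 1, whereas
    [sin (pi * x)] changes sign under integer shifts. *)
Lemma sin_pi_neq0 (R : realType) (x : R) :
  (forall p : int, x != p%:~R) -> sin (pi * x) != 0.
Proof.
move=> nx; have pi0 := pi_gt0 R.
pose p := Num.floor x; pose r := x - p%:~R.
have /andP[px xp] := floor_itv x; rewrite intrD in xp.
have r0 : 0 < r by rewrite subr_gt0 lt_neqAle eq_sym nx px.
have r1 : r < 1 by rewrite /r ltrBlDl.
have sr : 0 < sin (pi * r).
  by apply: sin_gt0_pi; rewrite mulr_gt0//= gtr_pMr.
have cE (y : R) : cos (2 * pi * y) = 1 - 2 * sin (pi * y) ^+ 2.
  rewrite (_ : 2 * pi * y = pi * y + pi * y); last by ring.
  by rewrite cosD -!expr2 cos2sin2; ring.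
apply/eqP => sx; have : cos (2 * pi * x) = cos (2 * pi * r).
  by rewrite -(cosDz _ (2 * pi * r) p) -mulrDr subrK.
rewrite !cE sx expr0n/= => h.
have : 0 < sin (pi * r) ^+ 2 by rewrite exprn_gt0.
have -> : sin (pi * r) ^+ 2 = 0 by lra.
by rewrite ltxx.
Qed.

Lemma row_mx11 (T : Type) (x y : 'rV[T]_1) :
  row_mx x y 0 0 = x 0 0 /\ row_mx x y 0 1 = y 0 0.
Proof.
split; [rewrite -(row_mxEl x y 0 0)|rewrite -(row_mxEr x y 0 0)].
  by congr (row_mx _ _ _ _); exact: val_inj.
by congr (row_mx _ _ _ _); exact: val_inj.
Qed.

(** Closeness [1 / (16 * pi)] turns the deviation [2 * pi * c] of the resonant averages into the
    [1 / 8] of [suitable]. *)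
Lemma eighth_over_2pi (R : realType) : 1 / 8 / (2 * pi) = 1 / (16 * pi) :> R.
Proof.
by move: (pi : R) (pi_gt0 R) => P P0; field; rewrite gt_eqF.
Qed.

(** * Suitable frequencies of a resonant rotation *)

Section SuitableFrequencies.
Variables (R : realType) (beta zeta : R) (w Delta : R -> R).
Hypothesis beta1 : 1 <= beta.
Hypothesis wc : weight_class beta w.
Hypothesis aD : approximation_function Delta.
Hypothesis zb : 0 < zeta < beta^-1.
Hypothesis De : forall x, 1 <= x -> Delta x <= expR (x `^ zeta).

Let De0 x : 1 <= x -> 0 <= Delta x <= expR (x `^ zeta).
Proof. by move=> x1; rewrite De// ltW// (approximation_function_gt0 _ _ aD). Qed.

Let small V omega := superpoly_small R beta zeta V omega Delta beta1 zb De0.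

Lemma suitable_dis (rho : R) : resonant R (1, rho) -> forall B, exists2 k,
  suitable R 1 Delta (dis_avg R w) (fun k => pairing k (vec1 rho)) k &
  (B <= height 1 k)%N.
Proof.
move=> [appr nres] B; have pi0 := pi_gt0 R.
have [c c0 [N1 hc]] := weight_sum_ge _ _ _ wc.
have e0 : 0 < 1 / (16 * pi) :> R by rewrite divr_gt0// mulr_gt0.
have [[q p] _ [/= q0 Kq h]] := appr _ (maxn B N1) e0.
move: Kq; rewrite geq_max => /andP[Bq Nq].
pose k : 'rV[int]_1 := const_mx q%:Z.
have kh : height 1 k = q.
  rewrite /height; have -> : `|k| = q%:Z; last by [].
  apply: le_anti; apply/andP; split.
    by apply: normr_row_le => // j; rewrite mxE ger0_norm.
  by apply: le_trans (normr_coord_le _ _ k 0); rewrite mxE ger0_norm.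
have kp : pairing k (vec1 rho) = q%:R * rho.
  by rewrite /pairing big_ord1 /vec1 !mxE eqxx mulr1n.
exists k; last by rewrite kh.
have h' : `|q%:R * rho - p%:~R| * q%:R <= 1 / (16 * pi).
  by move: h; rewrite /linear_form/= mulr1 mulrC => /ltW.
split.
- by apply/eqP => /rowP/(_ 0); rewrite !mxE => -[q00]; move: q0; rewrite q00.
- move=> psi; rewrite kh kp.
  apply: le_trans (dis_avg_resonant _ _ _ wc _ _ _ p (lt_le_trans c0 (hc _ Nq))) _.
  by rewrite mulrC (mulrC q%:R) -ler_pdivlMr ?mulr_gt0// eighth_over_2pi.
- apply: small; apply: (dis_avg_decay _ _ _ wc); rewrite kp.
  apply: sin_pi_neq0 => m; have := nres q m q0.
  by rewrite /linear_form/= mulr1 subr_eq0.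
Qed.

Lemma resonant_fst_neq0 (z : R * R) : resonant R z -> z.1 != 0.
Proof.
move=> [appr nres]; apply/eqP => z0.
have z20 : 0 < `|z.2|.
  rewrite normr_gt0; apply/eqP => z2; have := nres 1%N 0 isT.
  by rewrite /linear_form z0 z2 !mulr0 subrr eqxx.
have [[q p] _ [/= q0 _]] := appr _ 0%N z20.
rewrite /linear_form z0 mulr0 subr0 normrM ger0_norm// mulrA -natrM.
by rewrite gtr_pMl// ltNge ler1n muln_gt0 q0.
Qed.

(** The frequency is [(- p, q)]. The approximation is controlled by [q] but the time is the norm,
    which may be larger by a factor [C] depending on the rotation; the closeness is divided by [C]
    accordingly. *)
Lemma suitable_con (z : R * R) : resonant R z -> forall B, exists2 k,
  suitable R 2 Delta (con_avg R w) (fun k => pairing k (vec2 z)) k &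
  (B <= height 2 k)%N.
Proof.
move=> rz B; have z10 := resonant_fst_neq0 z rz; case: rz => [appr nres].
have pi0 := pi_gt0 R.
have z1p : 0 < `|z.1| by rewrite normr_gt0.
(* From [p * z.1 = q * z.2 - L] with [|L| < 1], one gets [|p| <= q * C]. *)
pose C := 1 + (`|z.2| + 1) / `|z.1|.
have C1 : 1 <= C by rewrite lerDl divr_ge0// addr_ge0.
have C0 : 0 < C := lt_le_trans ltr01 C1.
pose e := Num.min 1 (1 / (16 * pi) / C).
have e0 : 0 < e by rewrite lt_min ltr01 !divr_gt0// mulr_gt0.
have [[q p] _ [/= q0 Bq h]] := appr _ B e0.
have qp : 0 < q%:R :> R by rewrite ltr0n.
have q1 : 1 <= q%:R :> R by rewrite ler1n.
set L := linear_form R q p z in h.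
pose k : 'rV[int]_2 := row_mx (const_mx (- p) : 'rV_1) (const_mx q%:Z : 'rV_1).
have k0E : k 0 0 = - p by rewrite (row_mx11 _ _ _).1 mxE.
have k1E : k 0 1 = q%:Z by rewrite (row_mx11 _ _ _).2 mxE.
have kp : pairing k (vec2 z) = L.
  have v0 : vec2 z 0 0 = z.1 by rewrite (row_mx11 _ _ _).1 /vec1 mxE eqxx.
  have v1 : vec2 z 0 1 = z.2 by rewrite (row_mx11 _ _ _).2 /vec1 mxE eqxx.
  rewrite /pairing big_ord_recl big_ord1 (_ : lift ord0 ord0 = 1); last exact: val_inj.
  by rewrite k0E k1E v0 v1 /L /linear_form mulrNz -pmulrn; ring.
have qk : q%:R <= (height 2 k)%:R :> R.
  rewrite -heightE pmulrn ler_int; apply: le_trans (normr_coord_le _ _ k 1).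
  by rewrite k1E ger0_norm.
have L1 : `|L| < 1.
  apply: le_lt_trans (_ : q%:R * `|L| < _); first by rewrite ler_peMl.
  by apply: lt_le_trans h _; rewrite ge_min lexx.
have pC : `|p|%:~R <= q%:R * C.
  rewrite intr_norm -(ler_pM2r z1p) -normrM.
  have -> : p%:~R * z.1 = q%:R * z.2 - L by rewrite /L /linear_form; ring.
  apply: le_trans (ler_normB _ _) _; rewrite normrM (gtr0_norm qp).
  rewrite /C -mulrA mulrDl mul1r divfK ?gt_eqF// !mulrDr mulr1.
  rewrite addrCA lerD2l ler_wpDl ?mulr_ge0 ?(ltW qp)// (le_trans _ q1)//.
  exact: ltW.
have kC : (height 2 k)%:R <= q%:R * C.
  have : `|k| <= maxn `|p|%N q.
    apply: normr_row_le => // j.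
    have [->|->] : j = 0 \/ j = 1.
      by case: j => -[|[|]]// ?; [left|right]; exact: val_inj.
    + by rewrite k0E normrN -abszE lez_nat leq_max leqnn.
    + by rewrite k1E ger0_norm// lez_nat leq_max leqnn orbT.
  rewrite -(ler_int R) heightE => /le_trans; apply.
  rewrite -pmulrn /maxn; case: ifP => _; last by rewrite natr_absz.
  by rewrite ler_peMr// ltW.
have hp : (0 < height 2 k)%N by rewrite -(ltr0n R) (lt_le_trans qp).
exists k; last by rewrite (leq_trans Bq)// -(ler_nat R).
split.
- by apply/eqP => e1; move: k1E; rewrite e1 mxE => -[q00]; move: q0; rewrite -q00.
- move=> psi; rewrite kp.
  apply: le_trans (con_avg_resonant _ _ _ wc _ _ _ hp) _.
  rewrite mulrC -ler_pdivlMr ?mulr_gt0//.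
  apply: le_trans (_ : C * (q%:R * `|L|) <= _).
    by rewrite mulrA (mulrC C) ler_wpM2r.
  rewrite mulrC -ler_pdivlMr//; apply: le_trans (ltW h) _.
  rewrite /e ge_min; apply/orP; right.
  by rewrite eighth_over_2pi.
- apply: small; apply: (con_avg_decay _ _ _ wc); rewrite kp.
  exact: nres.
Qed.

End SuitableFrequencies.

Lemma infinite_set_of_injective (A : set nat) (g : nat -> nat) :
  injective g -> (forall n, A (g n)) -> infinite_set A.
Proof.
move=> ginj gA fA; apply: infinite_nat.
rewrite (_ : [set: nat] = g @^-1` A); last by apply/seteqP; split => // n _; exact: gA.
by apply: finite_preimage => // m n _ _; exact: ginj.
Qed.

Lemma increasing_injective (N : nat -> nat) :
  (forall m n, (m < n)%N -> (N m < N n)%N) -> injective N.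
Proof.
by move=> Nincr m n e; case: (ltngtP m n) => // /Nincr; rewrite e ltnn.
Qed.

Lemma increasing_cvgy (R : realType) (N : nat -> nat) :
  (forall m n, (m < n)%N -> (N m < N n)%N) ->
  (N n)%:R @[n --> \oo] --> (+oo : set_system R).
Proof.
move=> Nincr; have Nge n : (n <= N n)%N.
  by elim: n => // n IH; apply: leq_ltn_trans IH _; exact: Nincr.
apply/cvgryPge => A; near=> n.
apply: (@le_trans _ _ n%:R); last by rewrite ler_nat.
by near: n; exact: nbhs_infty_ger.
Unshelve. all: by end_near. Qed.

Section RationalPoints.
Variable R : realType.

(** Being countable and dense, it can be visited by one sequence of test points. *)
Definition rational_points : set 'rV[R]_1 :=
  [set x | exists r : rat, x = const_mx (ratr r)].

Lemma rational_points_torus : torus_set rational_points.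
Proof.
move=> _ k [r ->]; exists (r + (k 0 0)%:~R).
by apply/rowP => i; rewrite !mxE (ord1 i) rmorphD/= ratr_int.
Qed.

Lemma rational_points_dense : dense rational_points.
Proof.
move=> O [x Ox] oO; have /nbhs_ballP[e /= e0 xeO] := open_nbhs_nbhs (conj oO Ox).
have [r] := @rat_in_itvoo R (x 0 0 - e) (x 0 0 + e) ltac:(lra).
rewrite in_itv/= => /andP[r1 r2].
exists (const_mx (ratr r)); split; last by exists r.
apply: xeO; rewrite -ball_normE /ball_ /=.
apply: le_lt_trans (_ : `|x 0 0 - ratr r| < e).
  by apply: normr_row_le => // j; rewrite !mxE (ord1 j).
by rewrite ltr_norml; apply/andP; split; lra.
Qed.

End RationalPoints.

Lemma error_con_lattice (R : realType) d l (w : R -> R) (f : 'rV[R]_d -> 'rV[R]_l)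
    (rho : 'rV[R]_d) (k : 'rV[int]_d) (T : R) : Defs.periodic f ->
  error_con w f rho (lattice R k) T = error_con w f rho 0 T.
Proof.
move=> pf; have e s : f (rotation rho s (lattice R k)) = f (rotation rho s 0).
  by rewrite /rotation addrC pf add0r.
rewrite /error_con; set u := \row_i _; set v := \row_i _.
have -> // : u = v; apply/rowP => i; rewrite !mxE.
by apply: eq_Rintegral => s _; rewrite e.
Qed.

(** * Lower bounds at a resonant rotation *)

Section LowerBounds.
Variables (R : realType) (beta zeta : R) (w Delta : R -> R).
Hypothesis beta1 : 1 <= beta.
Hypothesis wc : weight_class beta w.
Hypothesis aD : approximation_function Delta.
Hypothesis zb : 0 < zeta < beta^-1.
Hypothesis De : forall x, 1 <= x -> Delta x <= expR (x `^ zeta).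

Lemma dis_pointwise (rho : R) l (vartheta : nat -> 'rV[R]_1) :
  gauge_summable Delta 1 0 -> resonant R (1, rho) -> (0 < l)%N ->
  exists2 f : 'rV[R]_1 -> 'rV[R]_l, observable Delta f & exists N : nat -> nat,
    [/\ forall n, (0 < N n)%N, forall m n, (m < n)%N -> (N m < N n)%N &
        forall n, 1 / (4 * Delta (N n)%:R) <= error_dis w f (vec1 rho) (vartheta n) (N n)].
Proof.
move=> gs res l0.
apply: (sparse_pointwise R 1 Delta aD gs (dis_avg R w) (fun k => pairing k (vec1 rho)) _ _ l
  (fun f => error_dis w f (vec1 rho))) => //.
- exact: (dis_avg_le1 _ _ _ wc).
- exact: (suitable_dis R beta zeta).
- by move=> a k phi theta N i N0 ca k0; exact: error_dis_ge.
Qed.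

Lemma dis_uniform (rho : R) l :
  gauge_summable Delta 1 0 -> resonant R (1, rho) -> (1 < l)%N ->
  exists2 f : 'rV[R]_1 -> 'rV[R]_l, observable Delta f & exists N : nat -> nat,
    [/\ forall n, (0 < N n)%N, forall m n, (m < n)%N -> (N m < N n)%N &
        forall n theta, 1 / (4 * Delta (N n)%:R) <= error_dis w f (vec1 rho) theta (N n)].
Proof.
move=> gs res l0.
apply: (sparse_uniform R 1 Delta aD gs (dis_avg R w) (fun k => pairing k (vec1 rho)) _ _ l
  (fun f => error_dis w f (vec1 rho))) => //.
- exact: (dis_avg_le1 _ _ _ wc).
- exact: (suitable_dis R beta zeta).
- by move=> a k phi theta N i N0 ca k0; exact: error_dis_ge.
Qed.

Lemma con_pointwise (rho : R * R) l (theta : 'rV[R]_2) :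
  gauge_summable Delta 2 0 -> resonant R rho -> (0 < l)%N ->
  exists2 f : 'rV[R]_2 -> 'rV[R]_l, observable Delta f &
    exists2 T : nat -> R, T @ \oo --> +oo &
      forall n, 1 / (4 * Delta (T n)) <= error_con w f (vec2 rho) theta (T n).
Proof.
move=> gs res l0.
have [||||f fobs [N [_ Nincr hN]]] :=
  sparse_pointwise R 2 Delta aD gs (con_avg R w) (fun k => pairing k (vec2 rho)) _ _ l
  (fun f theta N => error_con w f (vec2 rho) theta N%:R) _ (fun=> theta) _ => //.
- exact: (con_avg_le1 _ _ _ wc).
- exact: (suitable_con R beta zeta).
- by move=> a k phi x N i N0 ca k0; exact: (error_con_ge _ _ _ wc).
by exists f => //; exists (fun n => (N n)%:R) => //; exact: increasing_cvgy.
Qed.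

Lemma con_uniform (rho : R * R) l :
  gauge_summable Delta 2 0 -> resonant R rho -> (1 < l)%N ->
  exists2 f : 'rV[R]_2 -> 'rV[R]_l, observable Delta f &
    exists2 T : nat -> R, T @ \oo --> +oo &
      forall n theta, 1 / (4 * Delta (T n)) <= error_con w f (vec2 rho) theta (T n).
Proof.
move=> gs res l0.
have [||||f fobs [N [_ Nincr hN]]] :=
  sparse_uniform R 2 Delta aD gs (con_avg R w) (fun k => pairing k (vec2 rho)) _ _ l
  (fun f theta N => error_con w f (vec2 rho) theta N%:R) _ _ => //.
- exact: (con_avg_le1 _ _ _ wc).
- exact: (suitable_con R beta zeta).
- by move=> a k phi x N i N0 ca k0; exact: (error_con_ge _ _ _ wc).
by exists f => //; exists (fun n => (N n)%:R) => //; exact: increasing_cvgy.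
Qed.

End LowerBounds.

Theorem theorem3p1 (R : realType) (beta eps zeta : R) (w Delta : R -> R) :
  1 <= beta ->
  weight_class beta w ->
  approximation_function Delta ->
  0 < eps ->
  0 < zeta < beta^-1 ->
  (forall x, 1 <= x -> x `^ eps <= Delta x <= expR (x `^ zeta)) ->
  [/\ (* (I) *)
      (gauge_summable Delta 1 0 ->
       \forall rho \ae (@lebesgue_measure R), forall l : nat, (1 <= l)%N ->
         exists (Psi : 'rV[R]_1 -> 'rV[R]_l) (Xi : set 'rV[R]_1),
           [/\ observable Delta Psi, torus_set Xi, dense Xi, Xi 0
             & forall theta, Xi theta ->
                 infinite_set [set N : nat | (0 < N)%N /\
                   1 / (4 * Delta N%:R)
                     <= error_dis w Psi (vec1 rho) theta N]])
      /\
      (gauge_summable Delta 2 0 ->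
       \forall rho \ae (@lebesgue_measure R \x @lebesgue_measure R)%E,
         forall l : nat, (1 <= l)%N ->
         exists (Phi : 'rV[R]_2 -> 'rV[R]_l) (Theta : set 'rV[R]_2),
           [/\ observable Delta Phi, torus_set Theta, Theta 0
             & forall theta, Theta theta ->
                 exists2 T : nat -> R, T @ \oo --> +oo &
                   forall n, 1 / (4 * Delta (T n))
                     <= error_con w Phi (vec2 rho) theta (T n)]),
      (* (II) *)
      (gauge_summable Delta 1 0 ->
       \forall rho \ae (@lebesgue_measure R), forall l : nat, (2 <= l)%N ->
         exists Psi : 'rV[R]_1 -> 'rV[R]_l,
           observable Delta Psi /\
           infinite_set [set N : nat | (0 < N)%N /\
             forall theta, 1 / (4 * Delta N%:R)
               <= error_dis w Psi (vec1 rho) theta N])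
      /\
      (gauge_summable Delta 2 0 ->
       \forall rho \ae (@lebesgue_measure R \x @lebesgue_measure R)%E,
         forall l : nat, (2 <= l)%N ->
         exists Phi : 'rV[R]_2 -> 'rV[R]_l,
           observable Delta Phi /\
           exists2 T : nat -> R, T @ \oo --> +oo &
             forall n theta, 1 / (4 * Delta (T n))
               <= error_con w Phi (vec2 rho) theta (T n))
    & (* (III) *)
      (gauge_summable Delta 1 0 ->
       \forall rho \ae (@lebesgue_measure R), forall theta : 'rV[R]_1,
         forall l : nat, (1 <= l)%N ->
         exists Psi : 'rV[R]_1 -> 'rV[R]_l,
           observable Delta Psi /\
           infinite_set [set N : nat | (0 < N)%N /\
             1 / (4 * Delta N%:R) <= error_dis w Psi (vec1 rho) theta N])
      /\
      (gauge_summable Delta 2 0 ->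
       \forall rho \ae (@lebesgue_measure R \x @lebesgue_measure R)%E,
         forall theta : 'rV[R]_2, forall l : nat, (1 <= l)%N ->
         exists Phi : 'rV[R]_2 -> 'rV[R]_l,
           observable Delta Phi /\
           exists2 T : nat -> R, T @ \oo --> +oo &
             forall n, 1 / (4 * Delta (T n))
               <= error_con w Phi (vec2 rho) theta (T n))].
Proof.
move=> beta1 wc aD eps0 zb bD.
have De x : 1 <= x -> Delta x <= expR (x `^ zeta) by move=> /bD/andP[].
have ae1 : \forall rho \ae (@lebesgue_measure R), resonant R (1, rho).
  by apply: ae_resonant_section; exact: oner_neq0.
have ae2 := ae_resonant R.
have F1 := ae_filter_ringOfSetsType (@lebesgue_measure R).
have F2 := ae_filter_ringOfSetsType (@lebesgue_measure R \x @lebesgue_measure R)%E.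
split; split => gs.
- apply: (@filterS _ _ F1 _ _ _ ae1) => rho res l l1.
  (* Enumerating pairs [(r, j)] tests every rational point at infinitely many indices. *)
  pose vartheta n : 'rV[R]_1 :=
    if (unpickle n : option (rat * nat)) is Some (r, _) then const_mx (ratr r) else 0.
  have [f fobs [N [N0 Nincr hN]]] :=
    dis_pointwise R beta zeta w Delta beta1 wc aD zb De rho l vartheta gs res l1.
  exists f, (rational_points R); split => //.
  + exact: rational_points_torus.
  + exact: rational_points_dense.
  + by exists 0; apply/rowP => i; rewrite !mxE rmorph0.
  move=> _ [r ->].
  apply: (infinite_set_of_injective _ (fun j : nat => N (pickle (r, j)))).
    move=> i j /(increasing_injective _ Nincr)/(pcan_inj pickleK).
    by case.
  move=> j /=; split; first exact: N0.
  by have := hN (pickle (r, j)); rewrite /vartheta pickleK.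
- apply: (@filterS _ _ F2 _ _ _ ae2) => rho res l l1.
  have [f fobs [T Ty hT]] :=
    con_pointwise R beta zeta w Delta beta1 wc aD zb De rho l 0 gs res l1.
  (* The preimage of the single point 0 of the torus. *)
  exists f, [set theta | exists k, theta = lattice R k]; split => //.
  + by move=> _ k [k' ->]; exists (k' + k); apply/rowP => i; rewrite !mxE intrD.
  + by exists 0; apply/rowP => i; rewrite !mxE.
  + have pf : Defs.periodic f by case: fobs.
    move=> _ [k ->]; exists T; first exact: Ty.
    by move=> n; rewrite (error_con_lattice _ _ _ _ _ _ _ _ pf); exact: hT.
- apply: (@filterS _ _ F1 _ _ _ ae1) => rho res l l1.
  have [f fobs [N [N0 Nincr hN]]] :=
    dis_uniform R beta zeta w Delta beta1 wc aD zb De rho l gs res l1.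
  exists f; split => //; apply: (infinite_set_of_injective _ N) => //.
  exact: increasing_injective.
- apply: (@filterS _ _ F2 _ _ _ ae2) => rho res l l1.
  have [f fobs hf] :=
    con_uniform R beta zeta w Delta beta1 wc aD zb De rho l gs res l1.
  by exists f.
- apply: (@filterS _ _ F1 _ _ _ ae1) => rho res theta l l1.
  have [f fobs [N [N0 Nincr hN]]] :=
    dis_pointwise R beta zeta w Delta beta1 wc aD zb De rho l (fun=> theta) gs res l1.
  exists f; split => //; apply: (infinite_set_of_injective _ N) => //.
  exact: increasing_injective.
- apply: (@filterS _ _ F2 _ _ _ ae2) => rho res theta l l1.
  have [f fobs hf] :=
    con_pointwise R beta zeta w Delta beta1 wc aD zb De rho l theta gs res l1.
  by exists f.
Qed.
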